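(* Suppose that $(M,\mathbf m)$ is a metric projective structure of dimension $n\ge2$ with Weyl nullity at every point and that, with $\nabla$ the Levi-Civita connection of a metric $g\in\mathbf m$, the metrisability equation $$\nabla_a\sigma^{bc}+\delta^b_a\mu^c+\delta^c_a\mu^b=0$$ holds for some $\sigma^{bc}\in\Gamma(S^2TM(-2))$ and $\mu^b\in\Gamma(TM(-2))$. Then the (weighted) vector field $\mu^a$ satisfies $$\mu^b\,W^a{}_{bcd}=0$$ at every point.
   Context: Manifolds are smooth and connected; metrics have arbitrary signature; indices are abstract. Two metrics are projectively equivalent if they have the same geodesics up to reparametrisation; a metric projective structure $\mathbf m$ is an equivalence class of projectively equivalent metrics. For the Levi-Civita connection $\nabla$ of $g$: $[\nabla_\ell,\nabla_k]v^j=R^j{}_{i\ell k}v^i$, $R_{jk}=R^a{}_{jak}$, $\mathsf P_{jk}=\frac1{n-1}R_{jk}$. The projective Weyl tensor $W^i{}_{jk\ell}=R^i{}_{jk\ell}+\delta^i_\ell\mathsf P_{jk}-\delta^i_k\mathsf P_{j\ell}$ is the same for all $g\in\mathbf m$. $(M,\mathbf m)$ has Weyl nullity at $x$ if there is $0\ne v\in T_xM$ with $W^i{}_{jk\ell}v^j=0$ at $x$. $\mathcal E(1)$ is the positive $(2n+2)$-nd root of $(\Lambda^nTM)^2$, $\mathcal E(w)$ its real powers, $\mathcal B(w)=\mathcal B\otimes\mathcal E(w)$; $\nabla$ acts on these in the induced way. (The metric $g$ trivialises the density bundles by parallel sections, so one may equivalently take $\sigma^{bc}$ and $\mu^b$ unweighted.)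 *)

(* Defs.v *)
From HB Require Import structures.
From mathcomp Require Import all_boot all_order all_algebra.
From mathcomp Require Import all_classical all_reals all_analysis.

Set Implicit Arguments.
Unset Strict Implicit.
Unset Printing Implicit Defensive.

Import Order.TTheory GRing.Theory Num.Theory.
Import numFieldNormedType.Exports.

Local Open Scope classical_set_scope.
Local Open Scope ring_scope.

Section Smooth.
Context {R : realType}.

Definition partial n (i : 'I_n) (f : 'rV[R]_n -> R) (x : 'rV[R]_n) : R :=
  'D_(delta_mx 0 i) f x.

(* On an open set U this is the usual class C^k: a map is C^(k+1) iff it is
   differentiable and all its partial derivatives are C^k. *)
Fixpoint Ck n (k : nat) (U : set 'rV[R]_n) (f : 'rV[R]_n -> R) : Prop :=
  match k with
  | 0 => forall x, U x -> {for x, continuous f}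
  | k'.+1 => (forall x, U x -> differentiable f x) /\
             (forall i, Ck k' U (partial i f))
  end.

Definition smooth n (U : set 'rV[R]_n) (f : 'rV[R]_n -> R) : Prop :=
  forall k, Ck k U f.

Definition smooth1 (I : set R) (f : R -> R) : Prop :=
  forall k t, I t -> derivable (derive1n k f) t 1.

End Smooth.

(* The maps chart_map c and chart_inv c are meaningful only on dom c and on
   chart_map c @` dom c respectively. *)
Record manifold (R : realType) (n : nat) := Manifold {
  points :> topologicalType;
  chart : Type;
  dom : chart -> set points;
  chart_map : chart -> points -> 'rV[R]_n;
  chart_inv : chart -> 'rV[R]_n -> points;
  points_hausdorff : hausdorff_space points;
  points_second_countable : @second_countable points;
  points_connected : connected [set: points];
  dom_open : forall c, open (dom c);
  image_open : forall c, open (chart_map c @` dom c);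
  dom_cover : forall p, exists c, dom c p;
  chart_mapK : forall c p, dom c p -> chart_inv c (chart_map c p) = p;
  chart_map_continuous : forall c p, dom c p -> {for p, continuous (chart_map c)};
  chart_inv_continuous : forall c x, (chart_map c @` dom c) x ->
    {for x, continuous (chart_inv c)};
  transition_smooth : forall c d (j : 'I_n),
    smooth (chart_map c @` (dom c `&` dom d))
           (fun x => chart_map d (chart_inv c x) 0 j) }.

Section Tensors.
Context {R : realType} {n : nat} (M : manifold R n).

Definition chart_image (c : chart M) : set 'rV[R]_n := chart_map c @` dom c.

(* (transition_mx c d p) i j = d y^j / d x^i at p, for x = chart_map c and
   y = chart_map d: the components v of a tangent vector (as a row) change
   from c to d by v |-> v *m transition_mx c d p. *)
Definition transition_mx (c d : chart M) (p : M) : 'M[R]_n :=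
  'J (chart_map d \o chart_inv c) (chart_map c p).

(* A section of (Lambda^n TM)^2 changes by \det J ^+ 2, hence one of its
   positive (2n+2)-nd root E(1) by |\det J| `^ (1 / (n+1)). *)
Definition density_factor (w : R) (c d : chart M) (p : M) : R :=
  `|\det (transition_mx c d p)| `^ (w / n.+1%:R).

(* In the following records the argument of the components in the chart c is
   the coordinate vector x, and only the values for x in chart_image c matter. *)
Record metric := Metric {
  metric_comp :> chart M -> 'rV[R]_n -> 'M[R]_n;
  metric_smooth : forall c i j, smooth (chart_image c) (fun x => metric_comp c x i j);
  metric_sym : forall c x, chart_image c x -> (metric_comp c x)^T = metric_comp c x;
  metric_nondeg : forall c x, chart_image c x -> metric_comp c x \in unitmx;
  metric_change : forall c d p, dom c p -> dom d p ->
    metric_comp c (chart_map c p) =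
      transition_mx c d p *m metric_comp d (chart_map d p)
        *m (transition_mx c d p)^T }.

(* Gamma(TM(w)) *)
Record wvector (w : R) := WVector {
  wvector_comp :> chart M -> 'rV[R]_n -> 'rV[R]_n;
  wvector_smooth : forall c j, smooth (chart_image c) (fun x => wvector_comp c x 0 j);
  wvector_change : forall c d p, dom c p -> dom d p ->
    wvector_comp d (chart_map d p) =
      density_factor w c d p *: (wvector_comp c (chart_map c p)
                                   *m transition_mx c d p) }.

(* Gamma(S^2 TM(w)) *)
Record wsym2 (w : R) := WSym2 {
  wsym2_comp :> chart M -> 'rV[R]_n -> 'M[R]_n;
  wsym2_smooth : forall c i j, smooth (chart_image c) (fun x => wsym2_comp c x i j);
  wsym2_sym : forall c x, chart_image c x -> (wsym2_comp c x)^T = wsym2_comp c x;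
  wsym2_change : forall c d p, dom c p -> dom d p ->
    wsym2_comp d (chart_map d p) =
      density_factor w c d p *: ((transition_mx c d p)^T
        *m wsym2_comp c (chart_map c p) *m transition_mx c d p) }.

(* A vector of T_pM, as the family of its components in the charts around p;
   the values of v at the other charts are irrelevant. *)
Definition tangent_vector (p : M) (v : chart M -> 'rV[R]_n) : Prop :=
  forall c d, dom c p -> dom d p -> v d = v c *m transition_mx c d p.

Definition nonzero_vector (p : M) (v : chart M -> 'rV[R]_n) : Prop :=
  exists2 c, dom c p & v c != 0.

End Tensors.

Section Connection.
Context {R : realType} {n : nat} {M : manifold R n}.
Implicit Types (g : metric M) (c : chart M) (x : 'rV[R]_n).

(* Gamma^i_{jk}, where nabla_j v^i = d_j v^i + Gamma^i_{jk} v^k *)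
Definition christoffel g c (i j k : 'I_n) x : R :=
  2^-1 * \sum_e invmx (g c x) i e *
    (partial j (fun y => g c y e k) x + partial k (fun y => g c y e j) x
     - partial e (fun y => g c y j k) x).

(* The covariant derivative nabla_a sigma^{bc}. The connection induced on E(w)
   is nabla_a f = d_a f + w / (n+1) Gamma^e_{ea} f, because the one on
   Lambda^n TM is nabla_a f = d_a f + Gamma^e_{ea} f. *)
Definition cov_sym2 g (w : R) (s : wsym2 M w) (ch : chart M) x
    (a b c : 'I_n) : R :=
  partial a (fun y => s ch y b c) x
  + \sum_e christoffel g ch b a e x * s ch x e c
  + \sum_e christoffel g ch c a e x * s ch x b e
  + w / n.+1%:R * (\sum_e christoffel g ch e e a x) * s ch x b c.

Definition metrisability_eq g (s : wsym2 M (-2)) (mu : wvector M (-2)) : Prop :=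
  forall (ch : chart M) x, chart_image ch x -> forall a b c : 'I_n,
    cov_sym2 g s ch x a b c
    + (b == a)%:R * mu ch x 0 c + (c == a)%:R * mu ch x 0 b = 0.

(* riemann g c x j i l k = R^j_{ilk}, from
   (nabla_l nabla_k - nabla_k nabla_l) v^j = R^j_{ilk} v^i *)
Definition riemann g c x (j i l k : 'I_n) : R :=
  partial l (christoffel g c j k i) x - partial k (christoffel g c j l i) x
  + \sum_e (christoffel g c j l e x * christoffel g c e k i x
            - christoffel g c j k e x * christoffel g c e l i x).

Definition ricci g c x (j k : 'I_n) : R := \sum_a riemann g c x a j a k.

Definition schouten g c x (j k : 'I_n) : R := ricci g c x j k / n.-1%:R.

Definition weyl g c x (i j k l : 'I_n) : R :=
  riemann g c x i j k l + (i == l)%:R * schouten g c x j k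
  - (i == k)%:R * schouten g c x j l.

(* The projective Weyl tensor is the same for all metrics of a metric
   projective structure, so it is computed with a chosen representative g. *)
Definition weyl_nullity g (p : M) : Prop :=
  exists v : chart M -> 'rV[R]_n,
    [/\ tangent_vector p v, nonzero_vector p v &
      forall c, dom c p -> forall i k l : 'I_n,
        \sum_j weyl g c (chart_map c p) i j k l * v c 0 j = 0].

(* Affinely parametrised geodesics, defined on an open interval I. *)
Definition geodesic g (I : set R) (gamma : R -> M) : Prop :=
  [/\ open I, is_interval I, (forall t, I t -> {for t, continuous gamma}),
      (forall c j, smooth1 (I `&` gamma @^-1` dom c)
                           (fun t => chart_map c (gamma t) 0 j)) &
      forall c t, I t -> dom c (gamma t) -> forall i : 'I_n,
        let q j := fun u => chart_map c (gamma u) 0 j in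
        derive1n 2 (q i) t + \sum_j \sum_k christoffel g c i j k (chart_map c (gamma t))
                         * derive1 (q j) t * derive1 (q k) t = 0].

Definition reparametrisation (J I : set R) (tau : R -> R) : Prop :=
  [/\ open J, is_interval J, smooth1 J tau,
      (forall t, J t -> derive1 tau t != 0) & set_bij J I tau].

Definition geodesics_up_to_param g g' : Prop :=
  forall I gamma, geodesic g I gamma ->
    exists J tau, reparametrisation J I tau /\ geodesic g' J (gamma \o tau).

Definition projectively_equivalent g g' : Prop :=
  geodesics_up_to_param g g' /\ geodesics_up_to_param g' g.

Definition metric_projective_structure (m : set (metric M)) : Prop :=
  exists g0, m = [set g | projectively_equivalent g0 g].

End Connection.

(* Main.v *)
(* Write lam = - mu, regard sigma as an endomorphism by means of g, and let
   (a o c) z = <c, z> a + <a, z> c. A null vector v of the Weyl tensor satisfies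
   R(x, y) v = K (<v, y> x - <v, x> y) for a scalar K, so v annihilates
   Z = R - K G, where G is the curvature tensor of constant curvature 1. The
   Ricci identity for sigma, contracted with v, then gives [Z(x, y), sigma] = 0
   and nabla lam = tau - K sigma, and the claim is equivalent to Z lam = 0.

   If n = 2 then Z = 0. If n > 2 and the claim fails somewhere, then Z lam is
   nowhere zero on a nonempty open set. There sigma is not a multiple of
   the identity on a nonempty open subset, since otherwise lam = 0; hence K and
   tau are differentiable on that subset, and the Ricci identity for lam gives
   Z(x, y) lam = b(x) sigma y - b(y) sigma x + e(x) y - e(y) x with 1-forms b, e.
   Linear algebra with v turns this into a relation S^2 = k S for
   S = sigma - theta. Differentiating the quadratic relation along m gives
   m o S lam + S m o lam - k m o lam = p(m) S + q(m), which forces lam to be a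
   sum of vectors w for which S or k - S is a multiple of w <w, _>. Since Z
   commutes with S and is skew, Z w = 0: a contradiction. *)
Require Import Defs.
From mathcomp Require Import all_boot all_order all_algebra.
From mathcomp Require Import all_classical all_reals all_analysis.
From mathcomp Require Import ring lra.
Set Implicit Arguments.
Unset Strict Implicit.
Unset Printing Implicit Defensive.
Import Order.TTheory GRing.Theory Num.Theory.
Import numFieldNormedType.Exports.
Local Open Scope classical_set_scope.
Local Open Scope ring_scope.

(** * Pointwise algebra of skew curvature tensors *)

Section PointwiseAlgebra.
Context {R : realFieldType} {V : lmodType R} (b : V -> V -> R).
Hypothesis bC : forall x y, b x y = b y x.
Hypothesis bDl : forall x y z, b (x + y) z = b x z + b y z.
Hypothesis bZl : forall k x z, b (k *: x) z = k * b x z.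
Hypothesis b_nondeg : forall x, (forall y, b x y = 0) -> x = 0.

Lemma bDr x y z : b z (x + y) = b z x + b z y.
Proof. by rewrite !(bC z) bDl. Qed.
Lemma bZr k x z : b z (k *: x) = k * b z x.
Proof. by rewrite !(bC z) bZl. Qed.
Lemma bNl x z : b (- x) z = - b x z.
Proof. by rewrite -scaleN1r bZl mulN1r. Qed.
Lemma bNr x z : b z (- x) = - b z x.
Proof. by rewrite !(bC z) bNl. Qed.
Lemma b0l z : b 0 z = 0.
Proof. by rewrite -(scale0r (0 : V)) bZl mul0r. Qed.
Lemma b0r z : b z 0 = 0.
Proof. by rewrite bC b0l. Qed.
Definition bE := (bDl, bDr, bZl, bZr, bNl, bNr, b0l, b0r).

Lemma b_inj x y : (forall z, b x z = b y z) -> x = y.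
Proof.
move=> h; apply/eqP; rewrite -subr_eq0; apply/eqP/b_nondeg => z.
by rewrite !bE h subrr.
Qed.

Lemma exists_dual w : w != 0 -> exists z, b w z = 1.
Proof.
move=> w0; apply/not_existsP => h; move/eqP: w0; apply; apply: b_nondeg => y.
apply: contrapT => /eqP wy; apply: (h ((b w y)^-1 *: y)).
by rewrite bZr mulVf.
Qed.

(** Otherwise the kernel of [b w] lies in that of [b s], and the form of [s] is a multiple of the
    form of [w]. *)
Lemma exists_dual_orth s w : ~ (exists k, s = k *: w) ->
  exists x, b w x = 0 /\ b s x = 1.
Proof.
move=> sw; apply/not_existsP => h; apply: sw.
have key x : b w x = 0 -> b s x = 0.
  move=> wx; apply: contrapT => /eqP sx; apply: (h ((b s x)^-1 *: x)).
  by rewrite !bE wx mulr0 mulVf.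
have [w0|w0] := eqVneq w 0.
  by exists 0; rewrite scale0r; apply: b_nondeg => y; apply: key; rewrite w0 b0l.
have [y wy] := exists_dual w0.
exists (b s y); apply: b_inj => z.
have : b s (z - b w z *: y) = 0 by apply: key; rewrite !bE wy; ring.
by rewrite !bE => e; lra.
Qed.

(** With [b a z = 1], pairing the value at [z] with [z] gives [2 * b c z = 0], and the value at [z]
    is then [c]. This cancels a nonzero factor in a symmetric product [a o c]. *)
Lemma sym_mul_eq0 a c : (forall x, b c x *: a + b a x *: c = 0) ->
  a != 0 -> c = 0.
Proof.
move=> h /exists_dual[z az].
have := h z; rewrite az scale1r => /(congr1 (b ^~ z)); rewrite !bE az => e.
have cz : b c z = 0 by lra.
by have := h z; rewrite cz az scale0r scale1r add0r.
Qed.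

(** * Tensors with skewness and pair symmetry that annihilate a vector *)

Section SkewTensor.
Variables (Z : V -> V -> V -> V) (v : V) (S : {linear V -> V}).
Hypothesis Z_skew : forall x y z w, b (Z x y z) w = - b z (Z x y w).
Hypothesis Z_pair : forall x y z w, b (Z x y z) w = b (Z z w x) y.
Hypothesis v0 : v != 0.
Hypothesis Z_v : forall x y, Z x y v = 0.
Hypothesis S_sym : forall x y, b (S x) y = b x (S y).

(** Pair symmetry takes [y] out of the second slot, and skewness brings it into the third. *)
Lemma skew_tensor_ker2 y : (forall x z, Z x z y = 0) -> forall x z, Z x y z = 0.
Proof.
by move=> Zy x z; apply: b_nondeg => w; rewrite Z_pair Z_skew Zy b0r oppr0.
Qed.

(** Skewness moves the third argument into a linear slot of [b]. *)
Lemma skew_tensorD x y z w : Z x y (z + w) = Z x y z + Z x y w.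
Proof. by apply: b_inj => u; rewrite !bE !Z_skew !bE; ring. Qed.

Lemma skew_tensorZ x y k z : Z x y (k *: z) = k *: Z x y z.
Proof. by apply: b_inj => u; rewrite !bE !Z_skew !bE; ring. Qed.

Lemma skew_tensor0 x y : Z x y 0 = 0.
Proof. by rewrite -[in LHS](scale0r (0 : V)) skew_tensorZ scale0r. Qed.

(** By pair symmetry [x] and [y] enter through [b (Z z u x) y], which is alternating in them and
    vanishes when either is [v]; what remains is a multiple of [b (Z z u w) w = 0]. *)
Lemma skew_tensor_dim2 w : (forall x, exists a c, x = a *: v + c *: w) ->
  forall x y z, Z x y z = 0.
Proof.
move=> vw x y z; have [a [c ->]] := vw x; have [a' [c' ->]] := vw y.
apply: b_nondeg => u; rewrite Z_pair skew_tensorD !skew_tensorZ Z_v scaler0 add0r.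
rewrite !bE Z_skew Z_v b0r oppr0.
have : b (Z z u w) w = - b (Z z u w) w by rewrite {1}Z_skew bC.
move=> e; have e0 : b (Z z u w) w = 0 by lra.
by rewrite e0; ring.
Qed.

(** The identity at [z0, y, v], paired with [v], makes [v] an eigenvector of [L]. At [x, v, z] its
    left side vanishes and its right side is the symmetric product of [v] with [L x - tau x]. *)
Lemma commutator_scalar (L : V -> V) :
  (forall x y, b (L x) y = b x (L y)) ->
  (forall x y z, Z x y (S z) - S (Z x y z) =
     b (L x) z *: y + b y z *: L x - (b (L y) z *: x + b x z *: L y)) ->
  exists tau, forall x, L x = tau *: x.
Proof.
move=> L_sym comm.
have [z0 vz0] := exists_dual v0.
have [tau Lv] : exists tau, L v = tau *: v.
  exists (b (L z0) v); apply: b_inj => y.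
  have := congr1 (b ^~ v) (comm z0 y v).
  rewrite !bE S_sym Z_v Z_skew Z_v !bE.
  rewrite !(L_sym _ v) (bC y v) (bC z0 v) vz0 (bC z0) (bC y) => e; lra.
exists tau => x; apply/eqP; rewrite -subr_eq0; apply/eqP.
apply: (@sym_mul_eq0 v) => // z; apply: b_inj => y.
have := congr1 (b ^~ y) (comm x v z).
rewrite !(skew_tensor_ker2 Z_v) linear0 Lv !bE; lra.
Qed.

Hypothesis dim_gt2 : forall p q, exists x, [/\ x != 0, b p x = 0 & b q x = 0].

(** The left side kills a nonzero vector orthogonal to [p] and [q]. *)
Lemma rank2_scalar p q a c t :
  (forall x, b p x *: a + b q x *: c = t *: x) -> t = 0.
Proof.
have [x [x0 px qx]] := dim_gt2 p q => /(_ x).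
rewrite px qx !scale0r addr0 => /esym/eqP.
by rewrite scaler_eq0 (negbTE x0) orbF => /eqP.
Qed.

Hypothesis Z_S : forall x y z, Z x y (S z) = S (Z x y z).

(** * Algebraic consequences of the Ricci identity for [lam] *)

Section Classification.
Variables be et lam : V.
Hypothesis Z_lam : forall x y, Z x y lam =
  b be x *: S y - b be y *: S x + (b et x *: y - b et y *: x).

Lemma ker_relation y : (forall x z, Z x z y = 0) -> forall x,
  b be x *: S y + b et x *: y = b be y *: S x + b et y *: x.
Proof.
move=> /skew_tensor_ker2 Zy x; have := Zy x lam; rewrite Z_lam => e.
by apply: b_inj => w; have := congr1 (b ^~ w) e; rewrite !bE; lra.
Qed.

(** The relation for [n] expresses [S x] through [S n], [n] and [x]. As [S n] is annihilated too,
    its relation, with [S x] eliminated, says that a multiple of the identity has rank at most 2,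
    hence is zero. *)
Lemma quadratic_of_transversal n : (forall x y, Z x y n = 0) -> b be n = 1 ->
  (forall x y, Z x y lam = 0) \/
  exists th ka, forall x,
    S (S x - th *: x) - th *: (S x - th *: x) = ka *: (S x - th *: x).
Proof.
move=> Zn ben; have Sx := ker_relation Zn.
have ZSn x y : Z x y (S n) = 0 by rewrite Z_S Zn linear0.
have := ker_relation ZSn; set c := b be (S n); set d := b et (S n) => SSx.
have rel x : b be x *: (S (S n) - c *: S n) + b et x *: (S n - c *: n)
    = (d - c * b et n) *: x.
  apply: b_inj => w; have := congr1 (b ^~ w) (SSx x).
  have := congr1 (b ^~ w) (Sx x); rewrite ben scale1r !bE => e1 e2.
  by nra.
have t0 := rank2_scalar rel.
(* Such an [x] forces [S n = c n], and [S + b et n] then has its image in the line of [n]. Without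
   it [et] is a multiple of [be] and [Z x y lam] cancels. *)
have [h|] := pselect (exists x, b be x = 0 /\ b et x != 0).
  right; exists (- b et n), (c + b et n) => x.
  have [x1 [bex1 etx1]] := h.
  have Sn : S n = c *: n.
    have := rel x1; rewrite t0 bex1 !scale0r add0r => /eqP.
    by rewrite scaler_eq0 (negbTE etx1) /= subr_eq0 => /eqP.
  have Tx : S x - - b et n *: x = (c * b be x + b et x) *: n.
    apply: b_inj => w; have := congr1 (b ^~ w) (Sx x).
    by rewrite Sn ben !bE; lra.
  rewrite Tx linearZ /= Sn.
  by apply: b_inj => w; rewrite !bE; ring.
move=> /forallNP h; left.
have etE x : b et x = b et n * b be x.
  have := h (x - b be x *: n); rewrite !bE ben => /not_andP[[]|].
    by ring.
  by move/negP; rewrite negbK => /eqP e; lra.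
move=> x y; apply: b_nondeg => w; rewrite Z_lam !(etE x) !(etE y).
have := congr1 (b ^~ w) (Sx x); have := congr1 (b ^~ w) (Sx y).
rewrite ben scale1r (etE x) (etE y) !bE => e1 e2.
have -> : b (S y) w = b be y * b (S n) w + b et n * b be y * b n w - b et n * b y w by lra.
have -> : b (S x) w = b be x * b (S n) w + b et n * b be x * b n w - b et n * b x w by lra.
by ring.
Qed.

(** Unless [be = 0], the relation for [v] gives [S v = th v] and [et = - th be], so that
    [Z x y lam = be(x) T y - be(y) T x] with [T = S - th]. *)
Lemma quadratic_of_orthogonal : b be v = 0 ->
  (forall x y, Z x y lam = 0) \/
  exists th ka, forall x,
    S (S x - th *: x) - th *: (S x - th *: x) = ka *: (S x - th *: x).
Proof.
move=> bev; have := ker_relation Z_v; rewrite bev => Sv.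
have etv : b et v = 0.
  apply: (@rank2_scalar be et (S v) v) => x.
  by rewrite Sv scale0r add0r.
rewrite etv in Sv.
have [be0|be0] := eqVneq be 0.
  left=> x y; rewrite Z_lam be0 !b0l.
  have et0 z : b et z = 0.
    have := Sv z; rewrite be0 !b0l !scale0r !add0r => /eqP.
    by rewrite scaler_eq0 (negbTE v0) orbF => /eqP.
  by rewrite !et0 !scale0r !subr0 addr0.
have [x0 bex0] := exists_dual be0.
pose th := - b et x0.
have [T TE] : exists T, forall x, T x = S x - th *: x by exists (fun x => S x - th *: x).
right; exists th.
have SvE : S v = th *: v.
  apply: b_inj => w; have := congr1 (b ^~ w) (Sv x0).
  by rewrite bex0 /th !bE; lra.
have etE x : b et x = - th * b be x.
  have [w vw] := exists_dual v0.
  by have := congr1 (b ^~ w) (Sv x); rewrite SvE !bE vw; lra.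
have SE x : S x = T x + th *: x by rewrite TE subrK.
have T_sym x y : b (T x) y = b x (T y) by rewrite !TE !bE S_sym; ring.
(* In symmetric products, [T be o T w = be o T (T w)]. The source is that [Z lam w] commutes with
   [S], rewritten by pair symmetry. *)
have key x y w : b (T be) x * b y (T w) + b x (T w) * b (T be) y =
    b be x * b (T (T w)) y + b be y * b (T (T w)) x.
  have e : b (Z lam w (S x)) y = b (Z lam w x) (S y) by rewrite Z_S S_sym.
  have Zlam x' y' : b (Z x' y' lam) w = b be x' * b (T y') w - b be y' * b (T x') w.
    by rewrite Z_lam !etE !SE !bE; ring.
  move: e; rewrite !(Z_pair lam) !Zlam !SE.
  rewrite ![b be (_ + _)]bDr.
  have TD u k : T (T u + k *: u) = T (T u) + k *: T u.
    by apply: b_inj => z; rewrite T_sym !bE !T_sym.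
  have tw z : b (T z) w = b (T w) z by rewrite T_sym bC.
  have ttw z : b (T (T z)) w = b (T (T w)) z by rewrite !T_sym bC !T_sym.
  have tb z : b be (T z) = b (T be) z by rewrite T_sym.
  rewrite !TD !bE !ttw !tw !tb (bC x (T w)) (bC y (T w)) => e.
  by lra.
have Tlin k u : T (k *: u) = k *: T u.
  by apply: b_inj => z; rewrite T_sym !bE !T_sym.
suff [ka h] : exists ka, forall x, T (T x) = ka *: T x by exists ka => x; rewrite -!TE h.
have [h|] := pselect (forall w, exists k, T w = k *: be).
  have [k bek] := h be; exists k => w; have [kw ->] := h w.
  by rewrite Tlin bek !scalerA mulrC.
move=> /existsNP[w0 /exists_dual_orth[z0 [bez0 wz0]]].
(* Evaluating [key] at [z0], orthogonal to [be] but not to [T w0], makes [be] an eigenvector of [T];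
   then [key] reads [be o (T (T w) - ka T w) = 0]. *)
have [ka Tbe] : exists ka, T be = ka *: be.
  have k0 := key z0 z0 w0.
  rewrite bez0 (bC z0) wz0 in k0.
  have Tz0 : b (T be) z0 = 0 by lra.
  exists (b (T (T w0)) z0); apply: b_inj => y; have := key z0 y w0.
  by rewrite bez0 Tz0 (bC z0) wz0 !bE; lra.
exists ka => w; apply/eqP; rewrite -subr_eq0; apply/eqP.
apply: (@sym_mul_eq0 be) => // x; apply: b_inj => y.
have := key x y w; rewrite Tbe !bE (bC y (T w)) (bC x (T w)); lra.
Qed.

Lemma quadratic_or_annihilated :
  (forall x y, Z x y lam = 0) \/
  exists th ka, forall x,
    S (S x - th *: x) - th *: (S x - th *: x) = ka *: (S x - th *: x).
Proof.
have [/quadratic_of_orthogonal//|bev] := eqVneq (b be v) 0.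
apply: (@quadratic_of_transversal ((b be v)^-1 *: v)).
  by move=> x y; rewrite skew_tensorZ Z_v scaler0.
by rewrite bZr mulVf.
Qed.

End Classification.

End SkewTensor.

(** * The differentiated quadratic relation *)

Section Projector.
Variables (Z : V -> V -> V -> V).
Hypothesis Z_skew : forall x y z w, b (Z x y z) w = - b z (Z x y w).
Variable lam : V.

(** With [b w z = 1], pairing [Z x y (T z) = T (Z x y z)] with [z] gives two opposite values, so
    [b w (Z x y z) = 0]. Hence [T] kills [Z x y z], and [Z x y (c w) = 0]. *)
Lemma commuting_rank1 (T : V -> V) w c :
  (forall x y z, Z x y (T z) = T (Z x y z)) ->
  (forall z, T z = (c * b w z) *: w) -> c != 0 -> forall x y, Z x y w = 0.
Proof.
move=> Z_T Tw c0 x y.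
have [->|/exists_dual[z wz]] := eqVneq w 0.
  by rewrite skew_tensor0.
have Tz : T z = c *: w by rewrite Tw wz mulr1.
have e : b w (Z x y z) = 0.
  have := congr1 (b ^~ z) (Z_T x y z).
  rewrite Z_skew Tz [T (Z _ _ _)]Tw !bE wz mulr1 -mulNr => /eqP.
  rewrite -subr_eq0 -mulrBl mulf_eq0 => /orP[/eqP c2|/eqP//].
  by case/eqP: c0; lra.
have := Z_T x y z; rewrite Tz [RHS]Tw e mulr0 scale0r skew_tensorZ //.
by move/eqP; rewrite scaler_eq0 (negbTE c0) /= => /eqP.
Qed.

(** The derivative of [T^2 = ka T] along [m], written out for symmetric [T]: the anticommutator of
    [T] with [m o lam], minus [ka] times [m o lam], lies in the span of [T] and the identity. *)
Definition projector_eq (T : V -> V) ka (p t : V -> R) := forall m z,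
  b (T lam) z *: m + b m z *: T lam + (b lam z *: T m + b (T m) z *: lam)
  - ka *: (b lam z *: m + b m z *: lam) = p m *: T z + t m *: z.

(** Paired with [T y], the terms in which [lam] or [m] occurs without [T] cancel by [T^2 = ka T]. *)
Lemma projector_eq_image T ka p t :
  (forall x y, b (T x) y = b x (T y)) -> (forall x, T (T x) = ka *: T x) ->
  projector_eq T ka p t -> forall m z y,
  b (T lam) z * b (T m) y + b (T m) z * b (T lam) y = (ka * p m + t m) * b (T z) y.
Proof.
move=> T_sym TT h m z y; have := congr1 (b ^~ (T y)) (h m z).
by rewrite !bE -!T_sym !TT !bE => e; lra.
Qed.

(** The previous identity at [m = lam] says that [c T] is twice the square of the form of [T lam];
    as this square is nonzero, so is [c]. *)
Lemma image_rank1 T ka p t :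
  (forall x y, b (T x) y = b x (T y)) -> (forall x, T (T x) = ka *: T x) ->
  projector_eq T ka p t -> T lam != 0 ->
  exists2 c, c != 0 & forall z, T z = (c * b (T lam) z) *: T lam.
Proof.
move=> T_sym TT h Tlam; have [z0 wz0] := exists_dual Tlam.
have key := projector_eq_image T_sym TT h lam.
set c := ka * p lam + t lam in key.
have c0 : c != 0.
  by apply/eqP => c0; have := key z0 z0; rewrite wz0 c0; lra.
exists (2 / c); first by rewrite mulf_neq0 ?invr_neq0 ?pnatr_eq0.
move=> z; apply: b_inj => y; apply: (mulfI c0).
by rewrite -key bZl; field.
Qed.

Lemma projector_image T ka p t :
  (forall x y, b (T x) y = b x (T y)) -> (forall x, T (T x) = ka *: T x) ->
  (forall x y z, Z x y (T z) = T (Z x y z)) ->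
  projector_eq T ka p t -> forall x y, Z x y (T lam) = 0.
Proof.
move=> T_sym TT Z_T h x y; have [->|Tlam] := eqVneq (T lam) 0.
  by rewrite skew_tensor0.
have [c c0 Tc] := image_rank1 T_sym TT h Tlam.
exact: commuting_rank1 Z_T Tc c0 x y.
Qed.

Hypothesis dim_gt2 : forall p q, exists x, [/\ x != 0, b p x = 0 & b q x = 0].

(* If [T] satisfies the equation then so does [ka - T], and [T lam] and
   [ka lam - T lam], whose sum is [ka lam], are both annihilated; the nilpotent
   case [ka = 0] needs dimension at least 3. *)
Lemma projector_annihilated T ka p t :
  (forall x y, b (T x) y = b x (T y)) -> (forall x, T (T x) = ka *: T x) ->
  (forall x y z, Z x y (T z) = T (Z x y z)) ->
  projector_eq T ka p t -> (exists m, T m != 0) -> forall x y, Z x y lam = 0.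
Proof.
move=> T_sym TT Z_T h [m0 Tm0].
have [ka0|ka0] := eqVneq ka 0; last first.
  have TB u w : T (u - w) = T u - T w.
    by apply: b_inj => z; rewrite T_sym !bE !T_sym.
  have TZ k u : T (k *: u) = k *: T u.
    by apply: b_inj => z; rewrite T_sym !bE !T_sym.
  have T'sym x y : b (ka *: x - T x) y = b x (ka *: y - T y).
    by rewrite !bE T_sym.
  have T'T' x : ka *: (ka *: x - T x) - T (ka *: x - T x) = ka *: (ka *: x - T x).
    by rewrite TB TZ TT subrr subr0.
  have Z_T' x y z : Z x y (ka *: z - T z) = ka *: Z x y z - T (Z x y z).
    by rewrite skew_tensorD // -scaleN1r !skew_tensorZ // Z_T scaleN1r.
  have h' : projector_eq (fun x => ka *: x - T x) ka p (fun m => - (ka * p m + t m)).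
    move=> m z; apply: b_inj => y; have := congr1 (b ^~ y) (h m z).
    by rewrite !bE => e; lra.
  move=> x y; apply: (scalerI ka0).
  rewrite scaler0 -skew_tensorZ // -(subrK (T lam) (ka *: lam)) skew_tensorD //.
  rewrite (projector_image T_sym TT Z_T h) addr0.
  exact: (projector_image T'sym T'T' Z_T' h').
have key := projector_eq_image T_sym TT h.
have [Tlam|Tlam] := eqVneq (T lam) 0; last first.
  have [c c0 Tc] := image_rank1 T_sym TT h Tlam.
  exfalso; set w := T lam in Tlam Tc.
  (* Here [T] has rank one and kills every [m] orthogonal to [w], so the equation makes [w o m] a
     multiple of [T], and [m] lies on the line of [w]. But the orthogonal of [w] has dimension at
     least 2. *)
  have par m : b w m = 0 -> exists k, m = k *: w.
    move=> wm; have Tm : T m = 0 by rewrite Tc wm mulr0 scale0r.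
    have hm z : b w z *: m + b m z *: w = p m *: T z + t m *: z.
      by rewrite -h ka0 Tm -/w scale0r subr0 scaler0 b0l scale0r !addr0.
    have tm : t m = 0.
      have [z [z0 wz mz]] := dim_gt2 w m.
      move/esym/eqP: (hm z); rewrite Tc wz mz !scale0r mulr0 scale0r scaler0 !add0r.
      by rewrite scaler_eq0 (negbTE z0) orbF => /eqP.
    have [z wz] := exists_dual Tlam.
    exists (p m * c - b m z); apply: b_inj => y; have := congr1 (b ^~ y) (hm z).
    by rewrite tm Tc wz !bE => e; lra.
  have [r wr] := exists_dual Tlam.
  have [m [mn0 wm rm]] := dim_gt2 w r.
  have [k mk] := par _ wm; move: rm.
  by rewrite mk bC bZl wr mulr1 => k0; move: mn0; rewrite mk k0 scale0r eqxx.
have t0 m : t m = 0.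
  have [y my] := exists_dual Tm0; have := key m m0 y.
  by rewrite Tlam my ka0 !b0l; lra.
(* The equation is now [lam o T m = p(m) T]. It puts all [T m] on one line, symmetry gives
   [T = q w <w, _>], and [lam] lies on the line of [w] as well. *)
have hm m z : b lam z *: T m + b (T m) z *: lam = p m *: T z.
  by have := h m z; rewrite Tlam t0 ka0 !b0l !scale0r scaler0 add0r subr0 addr0 add0r.
move=> x y; have [->|lam0] := eqVneq lam 0; first by rewrite skew_tensor0.
set w := T m0 in Tm0 *.
have pm0 : p m0 != 0.
  apply/eqP => p0; case/eqP: Tm0; apply: (sym_mul_eq0 _ lam0) => z.
  by have := hm m0 z; rewrite p0 scale0r addrC.
have Tz z : T z = (p m0)^-1 *: (b lam z *: w + b w z *: lam).
  by rewrite hm scalerA mulVf // scale1r.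
have Tw m : T m = (p m / p m0) *: w.
  apply/eqP; rewrite -subr_eq0; apply/eqP; apply: (sym_mul_eq0 _ lam0) => z.
  apply: b_inj => u; have := congr1 (b ^~ u) (hm m z).
  by rewrite (Tz z) !bE => e; lra.
have [y0 wy0] := exists_dual Tm0.
pose q := p y0 / p m0.
have Tq m : T m = (q * b w m) *: w.
  rewrite Tw; congr (_ *: _).
  have : b (T m) y0 = b m (T y0) by rewrite T_sym.
  by rewrite (Tw m) (Tw y0) !bE wy0 mulr1 (bC m).
have q0 : q != 0.
  by apply: contraNneq Tm0 => q0; rewrite /w Tq q0 mul0r scale0r.
have lamw : exists k, lam = k *: w.
  exists (p m0 * q - b lam y0); apply: b_inj => u.
  have := congr1 (b ^~ u) (Tz y0); rewrite Tq wy0 mulr1 scale1r !bE => e.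
  have := congr1 (fun r => p m0 * r) e; rewrite mulVKf // => e'; lra.
have [k ->] := lamw; rewrite skew_tensorZ //.
by rewrite (commuting_rank1 Z_T Tq q0) scaler0.
Qed.

End Projector.

(** * Splitting off constant curvature by means of a null vector *)

Section NullVector.
Variables (Rm : V -> V -> V -> V) (v : V).
Hypothesis R_skew : forall x y z w, b (Rm x y z) w = - b z (Rm x y w).
Hypothesis R_pair : forall x y z w, b (Rm x y z) w = b (Rm z w x) y.
Hypothesis v0 : v != 0.

(** Skewness gives [b (Rm x0 u v) v = 0], which makes [p] proportional to [b v]. *)
Lemma nullity_curvature (p : V -> R) :
  (forall x y, Rm x y v = p y *: x - p x *: y) ->
  exists K, forall x y, Rm x y v = K *: (b v y *: x - b v x *: y).
Proof.
move=> h; have [x0 vx0] := exists_dual v0.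
exists (p x0) => x y; rewrite h.
have key u : p u = p x0 * b v u.
  have := R_skew x0 u v v; rewrite (bC v (Rm _ _ _)) h !bE !(bC _ v) vx0 => e.
  by lra.
by rewrite (key x) (key y) scalerBr !scalerA.
Qed.

Variable K : R.
Hypothesis R_v : forall x y, Rm x y v = K *: (b v y *: x - b v x *: y).

Definition reduced_curv x y z := Rm x y z - K *: (b z y *: x - b z x *: y).
Local Notation Z := reduced_curv.

Lemma reduced_skew x y z w : b (Z x y z) w = - b z (Z x y w).
Proof. by rewrite /Z !bE R_skew !(bC z) !(bC w); ring. Qed.

Lemma reduced_pair x y z w : b (Z x y z) w = b (Z z w x) y.
Proof. by rewrite /Z !bE R_pair (bC x z) (bC w y); ring. Qed.

Lemma reduced_v x y : Z x y v = 0.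
Proof. by rewrite /Z R_v subrr. Qed.

Variables S L : {linear V -> V}.
Hypothesis S_sym : forall x y, b (S x) y = b x (S y).
Hypothesis L_sym : forall x y, b (L x) y = b x (L y).
Hypothesis integrability : forall x y z,
  Rm x y (S z) - S (Rm x y z) =
    b (L x) z *: y + b y z *: L x - (b (L y) z *: x + b x z *: L y).

Let La x := L x + K *: S x.

(** The commutator of the constant curvature part with [S] has the shape of the right side with [S]
    for [L], so removing it replaces [L] by [L + K S]. *)
Lemma reduced_integrability x y z : Z x y (S z) - S (Z x y z) =
    b (La x) z *: y + b y z *: La x - (b (La y) z *: x + b x z *: La y).
Proof.
apply: b_inj => w.
have := congr1 (b ^~ w) (integrability x y z).
rewrite /La /Z !bE !S_sym !bE.
have sw u t : b t (S u) = b u (S t) by rewrite -S_sym bC.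
rewrite (sw y z) (sw x z) (bC z x) (bC z y) => e; nra.
Qed.

Lemma integrability_scalar : exists tau,
  forall x, L x = tau *: x - K *: S x.
Proof.
have [|tau h] := commutator_scalar reduced_skew reduced_pair v0 reduced_v S_sym _ reduced_integrability.
  by move=> x y; rewrite /La !bE S_sym L_sym.
by exists tau => x; rewrite -h /La addrK.
Qed.

(** As [La] is scalar, the right side of [reduced_integrability] cancels. *)
Lemma reduced_commute x y z : Z x y (S z) = S (Z x y z).
Proof.
have [tau Lt] := integrability_scalar.
apply/eqP; rewrite -subr_eq0 reduced_integrability; apply/eqP/b_nondeg => w.
by rewrite /La !Lt !subrK !bE; ring.
Qed.

End NullVector.
End PointwiseAlgebra.

(** * Smooth functions and commuting partial derivatives *)

(** The first-order expansion of [f] at [x] serves for [g] too, and uniqueness identifies ['d f x]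
    as the differential of [g]. *)
Lemma differentiable_near {R : numFieldType} {V W : normedModType R}
    (f g : V -> W) (x : V) :
  (\forall y \near x, f y = g y) -> differentiable f x -> differentiable g x.
Proof.
move=> fg df; have dfc := diff_continuous df.
have gx : g \o shift x = cst (g x) + 'd f x +o_ 0 id.
  have /eqaddoP fo := diff_locally df.
  apply/eqaddoP => e e0; have := fo e e0; apply: filter_app.
  have : \forall h \near (0 : V), f (h + x) = g (h + x).
    by move: fg; rewrite (near_shift 0) /= subr0.
  apply: filter_app; near=> h => fgh.
  by rewrite /= !fctE /= fgh (nbhs_singleton fg).
apply/diff_locallyP; split.
  by rewrite (diff_unique dfc gx).
by rewrite (diff_unique dfc gx).
Unshelve. all: by end_near. Qed.

Section SmoothFunctions.
Context {R : realType} {n : nat} {U : set 'rV[R]_n}.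
Hypothesis U_open : open U.
Implicit Types (f g : 'rV[R]_n -> R) (i j : 'I_n) (x : 'rV[R]_n).

Lemma near_open x : U x -> \forall y \near x, U y.
Proof. by move=> Ux; apply: open_nbhs_nbhs. Qed.

Lemma partial_near i f g x : (\forall y \near x, f y = g y) ->
  partial i f x = partial i g x.
Proof. exact: near_eq_derive. Qed.

Lemma partial_eq_on i f g x : (forall y, U y -> f y = g y) -> U x ->
  partial i f x = partial i g x.
Proof.
move=> fg Ux; apply: partial_near.
by apply: (filterS _ (near_open Ux)) => y /fg.
Qed.

Lemma partialD i f g x : differentiable f x -> differentiable g x ->
  partial i (fun y => f y + g y) x = partial i f x + partial i g x.
Proof. by move=> df dg; rewrite /partial deriveD //; exact: diff_derivable. Qed.

Lemma partialM i f g x : differentiable f x -> differentiable g x ->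
  partial i (fun y => f y * g y) x = partial i f x * g x + f x * partial i g x.
Proof.
move=> df dg; rewrite /partial deriveM; try exact: diff_derivable.
by rewrite addrC mulrC.
Qed.

Lemma partialV i f x : differentiable f x -> f x != 0 ->
  partial i (fun y => (f y)^-1) x = - ((f x)^-1 * (f x)^-1 * partial i f x).
Proof.
move=> df f0; rewrite /partial deriveV //; last exact: diff_derivable.
by rewrite [LHS]mulNr expr2 invfM.
Qed.

Lemma partial_cst i c x : partial i (fun=> c : R) x = 0.
Proof. exact: derive_cst. Qed.

Lemma Ck_ext k f g : (forall y, U y -> f y = g y) -> Ck k U f -> Ck k U g.
Proof.
elim: k f g => [|k IH] f g fg /=.
  move=> cf x Ux; have := cf x Ux; rewrite /prop_for /continuous_at -(fg _ Ux) => cfx.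
  have fgx : {near nbhs x, f =1 g} by apply: (filterS _ (near_open Ux)) => y /fg.
  exact: cvg_trans (near_eq_cvg fgx) cfx.
move=> [df dpf]; split=> [x Ux|i]; last first.
  by apply: IH (dpf i) => y Uy; exact: partial_eq_on.
by apply: differentiable_near (df x Ux); apply: (filterS _ (near_open Ux)) => y /fg.
Qed.

(** Lowers the order of the undifferentiated factors in the product and inverse rules. *)
Lemma Ck_pred k f : Ck k.+1 U f -> Ck k U f.
Proof.
elim: k f => [|k IH] f [df dpf]; first by move=> x /df /differentiable_continuous.
by split=> // i; exact/IH/dpf.
Qed.

Lemma Ck_cst k c : Ck k U (fun=> c).
Proof.
elim: k c => [|k IH] c; first by move=> x _; exact: cst_continuous.
split=> [x _|i]; first exact: differentiable_cst.
by apply: Ck_ext (IH 0) => y _; rewrite partial_cst.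
Qed.

Lemma CkD k f g : Ck k U f -> Ck k U g -> Ck k U (fun x => f x + g x).
Proof.
elim: k f g => [|k IH] f g; first by move=> cf cg x Ux; exact: continuousD (cf x Ux) (cg x Ux).
move=> [df dpf] [dg dpg]; split=> [x Ux|i].
  exact: differentiableD (df x Ux) (dg x Ux).
apply: Ck_ext (IH _ _ (dpf i) (dpg i)) => y Uy.
by rewrite partialD //; [exact: df|exact: dg].
Qed.

Lemma CkM k f g : Ck k U f -> Ck k U g -> Ck k U (fun x => f x * g x).
Proof.
elim: k f g => [|k IH] f g; first by move=> cf cg x Ux; exact: continuousM (cf x Ux) (cg x Ux).
move=> Cf Cg; have [df dpf] := Cf; have [dg dpg] := Cg; split=> [x Ux|i].
  exact: differentiableM (df x Ux) (dg x Ux).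
apply: (Ck_ext _ (CkD (IH _ _ (dpf i) (Ck_pred Cg)) (IH _ _ (Ck_pred Cf) (dpg i)))) => y Uy.
by rewrite partialM //; [exact: df|exact: dg].
Qed.

Lemma CkV k f : (forall x, U x -> f x != 0) -> Ck k U f ->
  Ck k U (fun x => (f x)^-1).
Proof.
move=> f0; elim: k => [|k IH]; first by move=> cf x Ux; apply: continuousV (f0 x Ux) (cf x Ux).
move=> Cf; have [df dpf] := Cf; split=> [x Ux|i].
  exact: differentiableV (df x Ux) (f0 x Ux).
have CV := IH (Ck_pred Cf).
apply: (Ck_ext _ (CkM (Ck_cst k (-1)) (CkM (CkM CV CV) (dpf i)))) => y Uy.
by rewrite partialV ?mulN1r //; [exact: df|exact: f0].
Qed.

Lemma smooth_ext f g : (forall y, U y -> f y = g y) -> smooth U f -> smooth U g.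
Proof. by move=> fg Sf k; exact: Ck_ext fg (Sf k). Qed.

Lemma smooth_cst c : smooth U (fun=> c).
Proof. by move=> k; exact: Ck_cst. Qed.

Lemma smoothD f g : smooth U f -> smooth U g -> smooth U (fun x => f x + g x).
Proof. by move=> Sf Sg k; exact: CkD. Qed.

Lemma smoothM f g : smooth U f -> smooth U g -> smooth U (fun x => f x * g x).
Proof. by move=> Sf Sg k; exact: CkM. Qed.

Lemma smoothN f : smooth U f -> smooth U (fun x => - f x).
Proof.
by move=> Sf; apply: (smooth_ext _ (smoothM (smooth_cst (-1)) Sf)) => x _; rewrite mulN1r.
Qed.

Lemma smoothV f : (forall x, U x -> f x != 0) -> smooth U f ->
  smooth U (fun x => (f x)^-1).
Proof. by move=> f0 Sf k; exact: CkV. Qed.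

Lemma smooth_sum I (r : seq I) (P : pred I) (F : I -> 'rV[R]_n -> R) :
  (forall k, smooth U (F k)) -> smooth U (fun x => \sum_(k <- r | P k) F k x).
Proof.
move=> SF; elim: r => [|k r IH].
  by apply: smooth_ext (smooth_cst 0) => x _; rewrite big_nil.
case Pk: (P k); last by apply: smooth_ext IH => x _; rewrite big_cons Pk.
by apply: smooth_ext (smoothD (SF k) IH) => x _; rewrite big_cons Pk.
Qed.

Lemma smooth_prod I (r : seq I) (P : pred I) (F : I -> 'rV[R]_n -> R) :
  (forall k, smooth U (F k)) -> smooth U (fun x => \prod_(k <- r | P k) F k x).
Proof.
move=> SF; elim: r => [|k r IH].
  by apply: smooth_ext (smooth_cst 1) => x _; rewrite big_nil.
case Pk: (P k); last by apply: smooth_ext IH => x _; rewrite big_cons Pk.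
by apply: smooth_ext (smoothM (SF k) IH) => x _; rewrite big_cons Pk.
Qed.

Lemma smooth_partial i f : smooth U f -> smooth U (partial i f).
Proof. by move=> Sf k; have [_] := Sf k.+1; apply. Qed.

Lemma smooth_differentiable f x : smooth U f -> U x -> differentiable f x.
Proof. by move=> Sf; have [+ _] := Sf 1%N; apply. Qed.

Lemma smooth_continuous f x : smooth U f -> U x -> {for x, continuous f}.
Proof. by move=> Sf; exact: (Sf 0%N). Qed.

Lemma is_derive_line f y v (s : R) : differentiable f (s *: v + y) ->
  is_derive s 1 (fun r => f (r *: v + y)) ('D_v f (s *: v + y)).
Proof.
move=> df.
have e : (fun h : R => h^-1 *: (((fun r => f (r *: v + y)) \o shift s) (h *: 1) - f (s *: v + y)))
    = (fun h => h^-1 *: ((f \o shift (s *: v + y)) (h *: v) - f (s *: v + y))).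
  apply/funext => h /=; congr (_ *: (f _ - _)).
  by rewrite [h *: 1]mulr1 scalerDl addrA.
have := @diff_derivable _ _ _ f (s *: v + y) v df.
by split; rewrite /derivable /derive e.
Qed.

(** The mean value theorem is used twice: for [phi], a difference in direction [j] as a function of
    the shift in direction [i], and then for [psi], which varies the shift in direction [j]. *)
Lemma second_difference_MVT i j f x h : 0 < h -> smooth U f ->
  (forall s t : R, 0 <= s <= h -> 0 <= t <= h ->
     U (s *: delta_mx 0 i + (t *: delta_mx 0 j + x))) ->
  exists s t, [/\ 0 < s < h, 0 < t < h &
    f (h *: delta_mx 0 i + (h *: delta_mx 0 j + x))
    - f (h *: delta_mx 0 i + x) - (f (h *: delta_mx 0 j + x) - f x)
    = partial j (partial i f) (s *: delta_mx 0 i + (t *: delta_mx 0 j + x)) * h * h].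
Proof.
move=> h0 Sf box; set ei := delta_mx 0 i; set ej := delta_mx 0 j.
have hh : 0 <= h <= h by rewrite lexx ltW.
have h00 : 0 <= (0 : R) <= h by rewrite lexx ltW.
pose phi s := f (s *: ei + (h *: ej + x)) - f (s *: ei + x).
have box0 s : 0 <= s <= h -> U (s *: ei + x).
  by move=> sh; have := box s 0 sh h00; rewrite scale0r add0r.
have dphi s : 0 <= s <= h -> is_derive s 1 phi
    (partial i f (s *: ei + (h *: ej + x)) - partial i f (s *: ei + x)).
  move=> sh; apply: is_deriveB; apply: is_derive_line; apply: smooth_differentiable Sf _.
  - exact: box.
  - exact: box0.
have [||s] := MVT h0 (f := phi)
  (df := fun s => partial i f (s *: ei + (h *: ej + x)) - partial i f (s *: ei + x)).
- by move=> s; rewrite in_itv /= => /andP[s0 sh]; apply: dphi; rewrite !ltW.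
- apply: derivable_within_continuous => s; rewrite in_itv /= => sh.
  by have [] := dphi s sh.
rewrite in_itv /= => /andP[s0 sh] phiE.
have sh' : 0 <= s <= h by rewrite !ltW.
pose psi t := partial i f (t *: ej + (s *: ei + x)).
have Spf := smooth_partial i Sf.
have dpsi t : 0 <= t <= h -> is_derive t 1 psi
    (partial j (partial i f) (t *: ej + (s *: ei + x))).
  move=> th; apply: is_derive_line; apply: smooth_differentiable Spf _.
  by rewrite addrCA; exact: box.
have [||t] := MVT h0 (f := psi) (df := fun t => partial j (partial i f) (t *: ej + (s *: ei + x))).
- by move=> t; rewrite in_itv /= => /andP[t0 th]; apply: dpsi; rewrite !ltW.
- apply: derivable_within_continuous => t; rewrite in_itv /= => th.
  by have [] := dpsi t th.
rewrite in_itv /= => /andP[t0 th] psiE.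
exists s, t; split; [by rewrite s0|by rewrite t0|].
move: phiE psiE; rewrite /phi /psi !scale0r !add0r !subr0.
rewrite (addrCA (h *: ej)) (addrCA (t *: ej)) => e1 e2.
by rewrite -e2 -e1; ring.
Qed.

(** The second difference is symmetric in [i] and [j], so both mixed partials take a common value in
    each small box; by continuity their values at [x] are within [e / 2] of it. *)
Lemma partialC i j f x : smooth U f -> U x ->
  partial i (partial j f) x = partial j (partial i f) x.
Proof.
move=> Sf Ux; apply/eqP; rewrite -subr_eq0 -normr_le0; apply/ler_addgt0Pl => e e0.
rewrite addr0.
have cij := smooth_continuous (smooth_partial i (smooth_partial j Sf)) Ux.
have cji := smooth_continuous (smooth_partial j (smooth_partial i Sf)) Ux.
have e2 : 0 < e / 2 by lra.
move/cvgrPdist_lt : cij => /(_ _ e2) cij.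
move/cvgrPdist_lt : cji => /(_ _ e2) cji.
have [r /= r0 ball_r] := (nbhs_ballP x _).1 (filterI (near_open Ux) (filterI cij cji)).
(* Even for [i = j], where the two displacements add up, the box stays in the ball because
   [h + h < r]. *)
pose h := r / 3.
have h0 : 0 < h by rewrite divr_gt0.
have near_box k l (s t : R) : 0 <= s <= h -> 0 <= t <= h ->
    ball x r (s *: delta_mx 0 k + (t *: delta_mx 0 l + x)).
  move=> /andP[s0 sh] /andP[t0 th]; split=> // a c; rewrite -ball_normE /ball_ /= !mxE.
  have hE : h + h < r by rewrite /h; lra.
  rewrite distrC addrA addrK ger0_norm; last by rewrite addr_ge0 // mulr_ge0.
  apply: le_lt_trans hE; apply: lerD.
    by case: (_ && _); rewrite ?mulr1 ?mulr0 // ltW.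
  by case: (_ && _); rewrite ?mulr1 ?mulr0 // ltW.
have box k l s t : 0 <= s <= h -> 0 <= t <= h ->
    U (s *: delta_mx 0 k + (t *: delta_mx 0 l + x)).
  by move=> sh th; have [] := ball_r _ (near_box k l s t sh th).
have [s [t [sh th]]] := second_difference_MVT h0 Sf (box i j).
have [s' [t' [sh' th']]] := second_difference_MVT h0 Sf (box j i).
rewrite [h *: delta_mx 0 j + (h *: _ + _)]addrCA => E1 E2.
have lw (a : R) : 0 < a < h -> 0 <= a <= h by move=> /andP[? ?]; rewrite !ltW.
have [_ [+ _]] := ball_r _ (near_box j i s' t' (lw _ sh') (lw _ th')).
have [_ [_ +]] := ball_r _ (near_box i j s t (lw _ sh) (lw _ th)).
have hinj (a b c d : R) : c = a * h * h -> d = b * h * h -> c = d -> a = b.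
  by move=> -> -> /(mulIf (lt0r_neq0 h0))/(mulIf (lt0r_neq0 h0)).
rewrite -(hinj _ _ _ _ E1 E2); last by ring.
move: (partial i (partial j f) (_ + _)) => A.
move: (partial i (partial j f) x) (partial j (partial i f) x) => P Q d1 d2.
rewrite (splitr e) (le_trans (ler_distD A _ _)) // lerD // ltW //.
by rewrite distrC.
Qed.

End SmoothFunctions.

(** * Matrix-valued functions *)

Section MatrixFunctions.
Context {R : realType} {n : nat}.
Implicit Types (U : set 'rV[R]_n) (x : 'rV[R]_n) (k l : 'I_n).

Definition msmooth U p q (F : 'rV[R]_n -> 'M[R]_(p, q)) : Prop :=
  forall i j, smooth U (fun x => F x i j).

Definition mdiff p q (F : 'rV[R]_n -> 'M[R]_(p, q)) x : Prop :=
  forall i j, differentiable (fun y => F y i j) x.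

Definition dmx p q k (F : 'rV[R]_n -> 'M[R]_(p, q)) x : 'M[R]_(p, q) :=
  \matrix_(i, j) partial k (fun y => F y i j) x.

Lemma dmxE p q k (F : 'rV[R]_n -> 'M[R]_(p, q)) x i j :
  dmx k F x i j = partial k (fun y => F y i j) x.
Proof. by rewrite mxE. Qed.

Lemma msmooth_mdiff U p q (F : 'rV[R]_n -> 'M[R]_(p, q)) x :
  msmooth U F -> U x -> mdiff F x.
Proof. by move=> SF Ux i j; apply: smooth_differentiable (SF i j) Ux. Qed.

Lemma dmx_near p q k (F G : 'rV[R]_n -> 'M[R]_(p, q)) x :
  (\forall y \near x, F y = G y) -> dmx k F x = dmx k G x.
Proof.
move=> FG; apply/matrixP => i j; rewrite !mxE; apply: partial_near.
by apply: filterS FG => y ->.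
Qed.

Lemma dmx_cst p q k (A : 'M[R]_(p, q)) x : dmx k (fun=> A) x = 0.
Proof. by apply/matrixP => i j; rewrite !mxE partial_cst. Qed.

Lemma mdiffD p q (F G : 'rV[R]_n -> 'M[R]_(p, q)) x :
  mdiff F x -> mdiff G x -> mdiff (fun y => F y + G y) x.
Proof.
move=> dF dG i j; under eq_fun do rewrite mxE.
exact: differentiableD.
Qed.

Lemma dmxD p q k (F G : 'rV[R]_n -> 'M[R]_(p, q)) x :
  mdiff F x -> mdiff G x ->
  dmx k (fun y => F y + G y) x = dmx k F x + dmx k G x.
Proof.
move=> dF dG; apply/matrixP => i j; rewrite !mxE.
under eq_fun do rewrite mxE.
exact: partialD.
Qed.

Lemma mdiffZ p q (f : 'rV[R]_n -> R) (F : 'rV[R]_n -> 'M[R]_(p, q)) x :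
  differentiable f x -> mdiff F x -> mdiff (fun y => f y *: F y) x.
Proof.
move=> df dF i j; under eq_fun do rewrite mxE.
exact: differentiableM.
Qed.

Lemma dmxZ p q k (f : 'rV[R]_n -> R) (F : 'rV[R]_n -> 'M[R]_(p, q)) x :
  differentiable f x -> mdiff F x ->
  dmx k (fun y => f y *: F y) x = partial k f x *: F x + f x *: dmx k F x.
Proof.
move=> df dF; apply/matrixP => i j; rewrite !mxE.
under eq_fun do rewrite mxE.
exact: partialM.
Qed.

Lemma mdiffN p q (F : 'rV[R]_n -> 'M[R]_(p, q)) x :
  mdiff F x -> mdiff (fun y => - F y) x.
Proof.
by move=> dF i j; under eq_fun do rewrite mxE; exact: differentiableN.
Qed.

Lemma dmxN p q k (F : 'rV[R]_n -> 'M[R]_(p, q)) x :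
  mdiff F x -> dmx k (fun y => - F y) x = - dmx k F x.
Proof.
move=> dF; apply/matrixP => i j; rewrite !mxE.
under eq_fun do rewrite mxE.
by rewrite /partial deriveN //; exact: diff_derivable.
Qed.

Lemma mdiff_tr p q (F : 'rV[R]_n -> 'M[R]_(p, q)) x :
  mdiff F x -> mdiff (fun y => (F y)^T) x.
Proof. by move=> dF i j; under eq_fun do rewrite mxE. Qed.

Lemma dmx_tr p q k (F : 'rV[R]_n -> 'M[R]_(p, q)) x :
  dmx k (fun y => (F y)^T) x = (dmx k F x)^T.
Proof.
by apply/matrixP => i j; rewrite !mxE; under eq_fun do rewrite mxE.
Qed.

Lemma differentiable_bigsum I (r : seq I) (f : I -> 'rV[R]_n -> R) x :
  (forall i, differentiable (f i) x) ->
  differentiable (fun y => \sum_(i <- r) f i y) x.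
Proof.
move=> df; elim: r => [|i r IH].
  by under eq_fun do rewrite big_nil; exact: differentiable_cst.
by under eq_fun do rewrite big_cons; exact: differentiableD.
Qed.

Lemma partial_bigsum I k (r : seq I) (f : I -> 'rV[R]_n -> R) x :
  (forall i, differentiable (f i) x) ->
  partial k (fun y => \sum_(i <- r) f i y) x = \sum_(i <- r) partial k (f i) x.
Proof.
move=> df; elim: r => [|i r IH].
  by under eq_fun do rewrite big_nil; rewrite partial_cst big_nil.
under eq_fun do rewrite big_cons.
by rewrite partialD // ?IH ?big_cons //; exact: differentiable_bigsum.
Qed.

Lemma mdiffM p q r (F : 'rV[R]_n -> 'M[R]_(p, q)) (G : 'rV[R]_n -> 'M[R]_(q, r)) x :
  mdiff F x -> mdiff G x -> mdiff (fun y => F y *m G y) x.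
Proof.
move=> dF dG i j; under eq_fun do rewrite mxE.
by apply: differentiable_bigsum => a; exact: differentiableM.
Qed.

Lemma dmxM p q r k (F : 'rV[R]_n -> 'M[R]_(p, q)) (G : 'rV[R]_n -> 'M[R]_(q, r)) x :
  mdiff F x -> mdiff G x ->
  dmx k (fun y => F y *m G y) x = dmx k F x *m G x + F x *m dmx k G x.
Proof.
move=> dF dG; apply/matrixP => i j; rewrite !mxE.
under eq_fun do rewrite mxE.
rewrite partial_bigsum => [|a]; last exact: differentiableM.
rewrite -big_split; apply: eq_bigr => a _ /=.
by rewrite !mxE partialM.
Qed.

Lemma mdiff_cst p q (A : 'M[R]_(p, q)) x : mdiff (fun=> A) x.
Proof. by move=> i j; exact: differentiable_cst. Qed.

Section OpenSet.
Variable U : set 'rV[R]_n.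
Hypothesis U_open : open U.

Lemma dmx_eq_on p q k (F G : 'rV[R]_n -> 'M[R]_(p, q)) x :
  (forall y, U y -> F y = G y) -> U x -> dmx k F x = dmx k G x.
Proof.
move=> FG Ux; apply: dmx_near.
by apply: (filterS _ (near_open U_open Ux)) => y /FG.
Qed.

Lemma dmxC p q k l (F : 'rV[R]_n -> 'M[R]_(p, q)) x : msmooth U F -> U x ->
  dmx k (dmx l F) x = dmx l (dmx k F) x.
Proof.
move=> SF Ux; apply/matrixP => i j.
have E m : (fun y => dmx m F y i j) = partial m (fun y => F y i j).
  by apply/funext => y; rewrite dmxE.
transitivity (partial k (partial l (fun y => F y i j)) x); first by rewrite dmxE E.
transitivity (partial l (partial k (fun y => F y i j)) x).
  exact: (partialC U_open _ _ (SF i j) Ux).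
by rewrite dmxE E.
Qed.

Lemma msmooth_ext p q (F G : 'rV[R]_n -> 'M[R]_(p, q)) :
  (forall y, U y -> F y = G y) -> msmooth U F -> msmooth U G.
Proof. by move=> FG SF i j; apply: smooth_ext (SF i j) => // y /FG ->. Qed.

Lemma msmoothD p q (F G : 'rV[R]_n -> 'M[R]_(p, q)) :
  msmooth U F -> msmooth U G -> msmooth U (fun x => F x + G x).
Proof.
by move=> SF SG i j; under eq_fun do rewrite mxE; exact: smoothD.
Qed.

Lemma msmoothN p q (F : 'rV[R]_n -> 'M[R]_(p, q)) :
  msmooth U F -> msmooth U (fun x => - F x).
Proof. by move=> SF i j; under eq_fun do rewrite mxE; exact: smoothN. Qed.

Lemma msmoothZ p q f (F : 'rV[R]_n -> 'M[R]_(p, q)) :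
  smooth U f -> msmooth U F -> msmooth U (fun x => f x *: F x).
Proof. by move=> Sf SF i j; under eq_fun do rewrite mxE; exact: smoothM. Qed.

Lemma msmoothM p q r (F : 'rV[R]_n -> 'M[R]_(p, q)) (G : 'rV[R]_n -> 'M[R]_(q, r)) :
  msmooth U F -> msmooth U G -> msmooth U (fun x => F x *m G x).
Proof.
move=> SF SG i j; under eq_fun do rewrite mxE.
by apply: smooth_sum => // a; exact: smoothM.
Qed.

Lemma msmooth_tr p q (F : 'rV[R]_n -> 'M[R]_(p, q)) :
  msmooth U F -> msmooth U (fun x => (F x)^T).
Proof. by move=> SF i j; under eq_fun do rewrite mxE; exact: SF. Qed.

Lemma msmooth_cst p q (A : 'M[R]_(p, q)) : msmooth U (fun=> A).
Proof. by move=> i j; exact: smooth_cst. Qed.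

Lemma msmooth_dmx p q k (F : 'rV[R]_n -> 'M[R]_(p, q)) :
  msmooth U F -> msmooth U (dmx k F).
Proof. by move=> SF i j; under eq_fun do rewrite mxE; exact: smooth_partial. Qed.

Lemma smooth_det p (F : 'rV[R]_n -> 'M[R]_p) :
  msmooth U F -> smooth U (fun x => \det (F x)).
Proof.
move=> SF; apply: smooth_sum => // s; apply: smoothM => //; first exact: smooth_cst.
by apply: smooth_prod => // i.
Qed.

Lemma msmooth_inv p (F : 'rV[R]_n -> 'M[R]_p) :
  (forall x, U x -> F x \in unitmx) ->
  msmooth U F -> msmooth U (fun x => invmx (F x)).
Proof.
move=> uF SF.
have SV : smooth U (fun x => (\det (F x))^-1).
  apply: smoothV (smooth_det SF) => // x /uF.
  by rewrite unitmxE unitfE.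
apply: (@msmooth_ext _ _ (fun x => (\det (F x))^-1 *: \adj (F x))).
  by move=> x /uF uFx; rewrite /invmx uFx.
apply: msmoothZ => // i j; under eq_fun do rewrite mxE.
rewrite /cofactor; apply: smoothM => //; first exact: smooth_cst.
apply: smooth_det => a c; under eq_fun do rewrite !mxE.
exact: SF.
Qed.

End OpenSet.

Lemma dmx_scalar k (F : 'rV[R]_n -> 'M[R]_n) x :
  (\forall y \near x, is_scalar_mx (F y)) -> exists c, dmx k F x = c%:M.
Proof.
move=> sF.
have [[i0]|] := pselect (exists i : 'I_n, True); last first.
  by move=> /forallNP n0; exists 0; apply/matrixP => i; case: (n0 i).
move=> _; exists (dmx k F x i0 i0); apply/matrixP => i j; rewrite !mxE.
have [<-|ij] := eqVneq i j.
  rewrite mulr1n; apply: partial_near; apply: filterS sF => y /is_scalar_mxP[c ->].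
  by rewrite !mxE !eqxx.
rewrite mulr0n -(partial_cst k 0 x); apply: partial_near.
by apply: filterS sF => y /is_scalar_mxP[c ->]; rewrite mxE (negbTE ij).
Qed.

(** A linear form vanishing on the identity but not on [A]. An off-diagonal entry ([c = 0]) or a
    difference of two diagonal entries ([c = 1]) serves. *)
Lemma nonscalar_entry (A : 'M[R]_n) : ~~ is_scalar_mx A ->
  exists i j k l c, (i == j)%:R - c * (k == l)%:R = 0 :> R /\
    A i j - c * A k l != 0 :> R.
Proof.
move=> nA; apply: contrapT => h; case/negP: nA.
have hA i j k l c : (i == j)%:R - c * (k == l)%:R = 0 :> R -> A i j = c * A k l.
  move=> e; apply/eqP; rewrite -subr_eq0; apply/negPn/negP => a0; apply: h.
  by exists i, j, k, l, c.
have [[i0]|] := pselect (exists i : 'I_n, True); last first.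
  by move=> /forallNP n0; apply/is_scalar_mxP; exists 0; apply/matrixP => i; case: (n0 i).
move=> _; apply/is_scalar_mxP; exists (A i0 i0); apply/matrixP => i j.
rewrite mxE; have [<-|ij] := eqVneq i j.
  by rewrite (hA i i i0 i0 1) ?mul1r ?eqxx ?mulr1 ?subrr.
by rewrite (hA i j i0 i0 0) ?(negbTE ij) ?mul0r ?subrr.
Qed.

(* If [F] stays in the span of [S] and the identity, then [f S * F - f F * S] is
   scalar for every linear form [f] vanishing on the identity. *)
Lemma dmx_span (F S : 'rV[R]_n -> 'M[R]_n) x a b k :
  mdiff F x -> mdiff S x ->
  (\forall y \near x, exists a c, F y = a *: S y + c%:M) ->
  ~~ is_scalar_mx (S x) -> F x = a *: S x + b%:M ->
  exists a' b', dmx k F x = a' *: S x + b'%:M + a *: dmx k S x.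
Proof.
move=> dF dS FS /nonscalar_entry[i [j [r [s [c [e Sx0]]]]]] Fx.
pose f (A : 'M[R]_n) := A i j + (- c) * A r s.
have fS y u v : f (u *: S y + v%:M) = u * f (S y).
  rewrite /f !mxE -[v *+ _]mulr_natr -[v *+ (r == s)]mulr_natr.
  by rewrite -[RHS]addr0 -(mulr0 v) -e; ring.
have dcM G : mdiff G x -> differentiable (fun y => - c * G y r s) x.
  by move=> dG; apply: (@differentiableM _ _ (fun=> - c) (fun y => G y r s)).
have df G : mdiff G x -> differentiable (fun y => f (G y)) x.
  by move=> dG; apply: differentiableD => //; exact: dcM.
have pf G : mdiff G x -> partial k (fun y => f (G y)) x = f (dmx k G x).
  move=> dG; rewrite partialD //; last exact: dcM.
  rewrite partialM //.
  by rewrite partial_cst mul0r add0r /f !mxE.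
have dfSF := mdiffZ (df _ dS) dF.
have dfFS := mdiffZ (df _ dF) dS.
(* From [F y = u S y + v] follows [f (F y) = u * f (S y)], so the multiples of [S y] cancel whatever
   the regularity of [u] and [v] in [y]. *)
have [t] : exists t, dmx k (fun y => f (S y) *: F y - f (F y) *: S y) x = t%:M.
  apply: dmx_scalar; apply: filterS FS => y [u [v ->]].
  apply/is_scalar_mxP; exists (f (S y) * v).
  by rewrite fS scalerDr !scalerA (mulrC u) addrC addKr -scale_scalar_mx.
rewrite dmxD ?dmxN //; last exact: mdiffN.
rewrite !dmxZ //; try exact: df.
rewrite !pf // Fx fS; have : f (S x) != 0 by rewrite /f mulNr.
move: (dmx k F x) (dmx k S x) => A B f0 E.
exists ((f (S x))^-1 * (f A - a * f B)), ((f (S x))^-1 * (t - b * f B)).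
apply/matrixP => u v; have := congr1 (fun C : 'M[R]_n => C u v) E.
rewrite !mxE -(mulr_natr t) -(mulr_natr b) -(mulr_natr (_ * (t - _))) => E'.
have -> : A u v = (f (S x))^-1 * (f (S x) * A u v) by rewrite mulKf.
have -> : f (S x) * A u v = t * (u == v)%:R - f B * (a * S x u v + b * (u == v)%:R)
   + (f A * S x u v + a * f (S x) * B u v) by lra.
by field.
Qed.

End MatrixFunctions.

(** * Noncommutative identities behind the Ricci identities *)

Ltac mxexpand := rewrite ?(mulmxDl, mulmxDr, mulmxN, mulNmx, mulmxA, scalerDr, scalerN, opprD, opprK);
  rewrite -?scalemxAl -?scalemxAr
    ?(mulmxDl, mulmxDr, mulmxN, mulNmx, mulmxA, scalerDr, scalerN, opprD, opprK).

Section MatrixIdentities.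
Context {R : realType} {n : nat}.
Implicit Types A B S : 'M[R]_n.

(** [A], [B] stand for Gamma_k, Gamma_l, [A'], [B'] for d_l Gamma_k, d_k Gamma_l, and a [t] marks
    transposes. The hypothesis equates the mixed second derivatives of [g]. *)
Lemma curvature_skew_identity (g A At B Bt A' At' B' Bt' : 'M[R]_n) :
  (g *m A + At *m g) *m B + g *m B' + (Bt' *m g + Bt *m (g *m A + At *m g)) =
  (g *m B + Bt *m g) *m A + g *m A' + (At' *m g + At *m (g *m B + Bt *m g)) ->
  g *m (B' - A' + (A *m B - B *m A)) =
  - ((Bt' - At' + (Bt *m At - At *m Bt)) *m g).
Proof.
mxexpand => E; apply/matrixP => i j.
have := congr1 (fun C : 'M[R]_n => C i j) E.
rewrite !mxE; lra.
Qed.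

(** Same notation; [a], [b] are the density connection forms, [c] the common value of their cross
    derivatives, [Lk], [Ll] the derivatives of [lam], and [Xk], [Xl] those of sigma. The last
    hypothesis equates the mixed second derivatives of sigma. *)
Lemma ricci_sym2_identity (S A At B Bt A' At' B' Bt' : 'M[R]_n)
    (a b c : R) (ek el lam Lk Ll : 'cV[R]_n) (ekt elt lamt Lkt Llt : 'rV[R]_n)
    (Xk Xl : 'M[R]_n) :
  Xk = ek *m lamt + lam *m ekt - A *m S - S *m At - a *: S ->
  Xl = el *m lamt + lam *m elt - B *m S - S *m Bt - b *: S ->
  A *m el = B *m ek -> elt *m At = ekt *m Bt ->
  ek *m Llt + Ll *m ekt - (A' *m S + A *m Xl) - (Xl *m At + S *m At')
    - (c *: S + a *: Xl) =
  el *m Lkt + Lk *m elt - (B' *m S + B *m Xk) - (Xk *m Bt + S *m Bt')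
    - (c *: S + b *: Xk) ->
  (B' - A' + (A *m B - B *m A)) *m S + S *m (Bt' - At' + (Bt *m At - At *m Bt)) =
  el *m (Lkt + lamt *m At + a *: lamt) + (Lk + A *m lam + a *: lam) *m elt
  - (ek *m (Llt + lamt *m Bt + b *: lamt) + (Ll + B *m lam + b *: lam) *m ekt).
Proof.
move=> -> -> hT hTt; mxexpand.
have hT1 : B *m ek *m lamt = A *m el *m lamt by rewrite hT.
have hT2 : lam *m ekt *m Bt = lam *m elt *m At by rewrite -!mulmxA hTt.
rewrite hT1 hT2 => E; apply/matrixP => i j.
have := congr1 (fun C : 'M[R]_n => C i j) E.
rewrite !mxE; lra.
Qed.

(** [L2] is the mixed second derivative of [lam], common to both expansions. *)
Lemma ricci_vector_identity (A B A' B' : 'M[R]_n) (a b c : R)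
    (lam Lk Ll L2 DLk DLl : 'cV[R]_n) :
  DLk = L2 + (A' *m lam + A *m Ll) + (c *: lam + a *: Ll) ->
  DLl = L2 + (B' *m lam + B *m Lk) + (c *: lam + b *: Lk) ->
  (B' - A' + (A *m B - B *m A)) *m lam =
  DLl + A *m (Ll + B *m lam + b *: lam) + a *: (Ll + B *m lam + b *: lam)
  - (DLk + B *m (Lk + A *m lam + a *: lam) + b *: (Lk + A *m lam + a *: lam)).
Proof.
move=> -> ->; mxexpand; apply/matrixP => i j; rewrite !mxE; lra.
Qed.

(** After an index is lowered by [g], the connection acts on sigma by a commutator. *)
Lemma sym2_endo_derivative (g S A At E : 'M[R]_n) (a : R) :
  (E - A *m S - S *m At - a *: S) *m g + S *m (g *m A + At *m g) =
  E *m g - A *m (S *m g) + S *m g *m A - a *: (S *m g).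
Proof. by mxexpand; apply/matrixP => i j; rewrite !mxE; lra. Qed.

(** Substitutes [L = al S + ta] into the right side of the Ricci identity for [lam];
    torsion-freeness removes the connection terms. *)
Lemma ricci_span_identity (S L A B H K : 'M[R]_n) (al ta a b a' b' a'' b'' : R)
    (ek el : 'cV[R]_n) (DL DL' : 'M[R]_n) :
  L = al *: S + ta%:M -> A *m el = B *m ek ->
  DL = a' *: S + a''%:M + al *: (H - A *m S + S *m A - a *: S) ->
  DL' = b' *: S + b''%:M + al *: (K - B *m S + S *m B - b *: S) ->
  DL *m el + A *m (L *m el) + a *: (L *m el)
  - (DL' *m ek + B *m (L *m ek) + b *: (L *m ek)) =
  a' *: (S *m el) + (a'' + a * ta) *: el - (b' *: (S *m ek) + (b'' + b * ta) *: ek)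
  + al *: (H *m el - K *m ek).
Proof.
move=> -> hT -> ->; mxexpand; rewrite !mul_scalar_mx !mul_mx_scalar -?scalemxAl ?mulmxA.
have hT1 : S *m A *m el = S *m B *m ek by rewrite -!mulmxA hT.
by rewrite hT1 hT; apply/matrixP => i j; rewrite !mxE; lra.
Qed.

(** The commutator with [A] is a derivation, so it drops out of the differentiated relation; the
    weight term [a] only changes the coefficients. *)
Lemma quadratic_derivative_identity (S A H D : 'M[R]_n) (p q p' q' a : R) :
  D = H - A *m S + S *m A - a *: S ->
  S *m S = p *: S + q%:M -> D *m S + S *m D = p' *: S + q'%:M + p *: D ->
  H *m S + S *m H - p *: H = (p' + a * p) *: S + (q' + 2 * a * q)%:M.
Proof.
move=> -> S2; mxexpand => E; apply/matrixP => i j.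
have := congr1 (fun C : 'M[R]_n => C i j) E.
have e1 : S *m S *m A = p *: (S *m A) + q *: A.
  by rewrite S2 mulmxDl mul_scalar_mx scalemxAl.
have e2 : A *m S *m S = p *: (A *m S) + q *: A.
  by rewrite -mulmxA S2 mulmxDr mul_mx_scalar scalemxAr.
rewrite e1 e2 S2 !mxE -(mulr_natr q) -(mulr_natr q') -(mulr_natr (q' + _)); lra.
Qed.

End MatrixIdentities.

(** * Curvature at a point *)

Section Multilinear.
Context {R : realType} {n : nat}.
Implicit Types x y z w : 'cV[R]_n.

Definition cvec (k : 'I_n) : 'cV[R]_n := delta_mx k 0.

Lemma cvec_sum x : x = \sum_k x k 0 *: cvec k.
Proof.
apply/matrixP => i j; rewrite ord1 summxE (bigD1 i) //= !mxE !eqxx mulr1.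
rewrite big1 ?addr0 // => k ki.
by rewrite !mxE eq_sym (negbTE ki) mulr0.
Qed.

(** A predicate on bare functions, so that tensor identities reduce to coordinate vectors slot by
    slot. *)
Definition lin1 (W : lmodType R) (f : 'cV[R]_n -> W) :=
  forall a x y, f (a *: x + y) = a *: f x + f y.

Lemma lin1_sum (W : lmodType R) (f : 'cV[R]_n -> W) x :
  lin1 f -> f x = \sum_k x k 0 *: f (cvec k).
Proof.
move=> lf; have f0 : f 0 = 0.
  have := lf (-1) 0 0; rewrite scaler0 add0r => ->.
  by rewrite scaleN1r addNr.
rewrite {1}(cvec_sum x); elim: (index_enum _) => [|k s IH]; first by rewrite !big_nil.
by rewrite !big_cons lf IH.
Qed.

Lemma lin1_ext (W : lmodType R) (f h : 'cV[R]_n -> W) : lin1 f -> lin1 h ->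
  (forall k, f (cvec k) = h (cvec k)) -> forall x, f x = h x.
Proof.
move=> lf lh fh x; rewrite (lin1_sum x lf) (lin1_sum x lh).
by apply: eq_bigr => k _; rewrite fh.
Qed.

Definition gform (g : 'M[R]_n) x y : R := (x^T *m g *m y) 0 0.

Variable g : 'M[R]_n.
Local Notation b := (gform g).

Lemma gformDl x y z : b (x + y) z = b x z + b y z.
Proof. by rewrite /gform linearD /= !mulmxDl mxE. Qed.

Lemma gformZl k x z : b (k *: x) z = k * b x z.
Proof. by rewrite /gform linearZ /= -!scalemxAl mxE. Qed.

Lemma gform_mulmx (A : 'M[R]_n) x y : b (A *m x) y = (x^T *m (A^T *m g) *m y) 0 0.
Proof. by rewrite /gform trmx_mul !mulmxA. Qed.

Hypothesis g_sym : g^T = g.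

Lemma gformC x y : b x y = b y x.
Proof.
rewrite /gform; have -> : x^T *m g *m y = (y^T *m g *m x)^T.
  by rewrite !trmx_mul trmxK g_sym mulmxA.
by rewrite mxE.
Qed.

Hypothesis g_unit : g \in unitmx.

Lemma gform_nondeg x : (forall y, b x y = 0) -> x = 0.
Proof.
move=> h; have xg : x^T *m g = 0.
  apply/matrixP => i k; rewrite ord1 [RHS]mxE -(h (cvec k)) /gform /cvec.
  by rewrite -colE [RHS]mxE.
by apply: trmx_inj; rewrite trmx0 -(mulmxK g_unit x^T) xg mul0mx.
Qed.

Lemma gform_dual (p : 'I_n -> R) : exists u, forall k, b u (cvec k) = p k.
Proof.
exists ((\row_k p k) *m invmx g)^T => k.
by rewrite /gform trmxK mulmxKV // /cvec -colE !mxE.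
Qed.

(** A matrix with the two columns [g p] and [g q] has rank at most 2, hence a nonzero left
    kernel. *)
Lemma gform_dim_gt2 : (2 < n)%N ->
  forall p q, exists x, [/\ x != 0, b p x = 0 & b q x = 0].
Proof.
move=> n2 p q; pose A := row_mx (g *m p) (g *m q).
have : kermx A != 0.
  rewrite kermx_eq0 /row_free; apply: contraTneq n2 => <-.
  by rewrite -leqNgt (rank_leq_col A).
move/rowV0Pn => [r /sub_kermxP rA r0].
exists r^T; split; first by rewrite -(inj_eq (@trmx_inj _ _ _)) trmxK trmx0.
  rewrite gformC /gform trmxK -mulmxA.
  by move: rA; rewrite mul_mx_row -[RHS]row_mx0 => /eq_row_mx[-> _]; rewrite mxE.
rewrite gformC /gform trmxK -mulmxA.
by move: rA; rewrite mul_mx_row -[RHS]row_mx0 => /eq_row_mx[_ ->]; rewrite mxE.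
Qed.

Variable Rc : 'I_n -> 'I_n -> 'M[R]_n.

Definition curv_op x y z : 'cV[R]_n :=
  \sum_k \sum_l (x k 0 * y l 0) *: (Rc k l *m z).

Lemma curv_op_lin1 y z : lin1 (fun x => curv_op x y z).
Proof.
move=> a x x'; rewrite /curv_op scaler_sumr -big_split; apply: eq_bigr => k _.
rewrite scaler_sumr -big_split; apply: eq_bigr => l _ /=.
by rewrite !mxE mulrDl scalerDl scalerA mulrA.
Qed.

Lemma curv_op_lin2 x z : lin1 (fun y => curv_op x y z).
Proof.
move=> a y y'; rewrite /curv_op scaler_sumr -big_split; apply: eq_bigr => k _.
rewrite scaler_sumr -big_split; apply: eq_bigr => l _ /=.
by rewrite !mxE mulrDr scalerDl scalerA mulrCA.
Qed.

Lemma curv_op_lin3 x y : lin1 (curv_op x y).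
Proof.
move=> a z z'; rewrite /curv_op scaler_sumr -big_split; apply: eq_bigr => k _.
rewrite scaler_sumr -big_split; apply: eq_bigr => l _ /=.
by rewrite mulmxDr scalerDr -scalemxAr !scalerA (mulrC a).
Qed.

Lemma curv_op_cvec k l z : curv_op (cvec k) (cvec l) z = Rc k l *m z.
Proof.
rewrite /curv_op (bigD1 k) //= [X in _ + X]big1 => [|i ik].
  rewrite addr0 (bigD1 l) //= [X in _ + X]big1 => [|j jl].
    by rewrite !mxE !eqxx mulr1 scale1r addr0.
  by rewrite !mxE (negbTE jl) mulr0 scale0r.
by apply: big1 => j _; rewrite !mxE (negbTE ik) mul0r scale0r.
Qed.

Lemma bilinear_ext (W : lmodType R) (f h : 'cV[R]_n -> 'cV[R]_n -> W) :
  (forall y, lin1 (f ^~ y)) -> (forall x, lin1 (f x)) ->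
  (forall y, lin1 (h ^~ y)) -> (forall x, lin1 (h x)) ->
  (forall k l, f (cvec k) (cvec l) = h (cvec k) (cvec l)) ->
  forall x y, f x y = h x y.
Proof.
move=> f1 f2 h1 h2 fh x y; apply: (lin1_ext (f1 y) (h1 y)) => k.
exact: (lin1_ext (f2 _) (h2 _)).
Qed.

Hypothesis Rc_anti : forall k l, Rc k l = - Rc l k.
Hypothesis Rc_skew : forall k l, g *m Rc k l = - ((Rc k l)^T *m g).
Hypothesis Rc_bianchi : forall k l m,
  Rc k l *m cvec m + Rc l m *m cvec k + Rc m k *m cvec l = 0.
Local Notation Rm := curv_op.
Let bE' := bE gformC gformDl gformZl.

Let lin_comp (f : 'cV[R]_n -> 'cV[R]_n) w : lin1 f -> lin1 (fun x => b (f x) w : R^o).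
Proof. by move=> lf a x y; rewrite lf !bE'. Qed.

Lemma curv_op_anti x y z : Rm x y z = - Rm y x z.
Proof.
rewrite /curv_op exchange_big -sumrN; apply: eq_bigr => l _ /=.
rewrite -sumrN; apply: eq_bigr => k _.
by rewrite Rc_anti mulNmx scalerN mulrC.
Qed.

Lemma curv_op_skew x y z w : b (Rm x y z) w = - b z (Rm x y w).
Proof.
rewrite (gformC z).
apply: (@bilinear_ext R^o (fun x y => b (Rm x y z) w) (fun x y => - b (Rm x y w) z)) x y.
- by move=> y; apply: lin_comp; exact: curv_op_lin1.
- by move=> x; apply: lin_comp; exact: curv_op_lin2.
- by move=> y a x x'; rewrite curv_op_lin1 !bE' opprD -mulrN.
- by move=> y a x x'; rewrite curv_op_lin2 !bE' opprD -mulrN.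
move=> k l; rewrite !curv_op_cvec (gformC _ z) gform_mulmx.
by rewrite -[_^T *m g]opprK -Rc_skew mulmxN mulNmx mxE /gform !mulmxA.
Qed.

Lemma curv_op_bianchi x y z : Rm x y z + Rm y z x + Rm z x y = 0.
Proof.
pose f x y z w := b (Rm x y z) w + b (Rm y z x) w + b (Rm z x y) w.
have f1 y' z' w : lin1 (fun x' => f x' y' z' w : R^o).
  move=> a x1 x2; rewrite /f curv_op_lin1 curv_op_lin2 curv_op_lin3 !bE' /=.
  by rewrite [a *: _]mulrDr mulrDr; ring.
have f2 x' z' w : lin1 (fun y' => f x' y' z' w : R^o).
  move=> a x1 x2; rewrite /f curv_op_lin1 curv_op_lin2 curv_op_lin3 !bE' /=.
  by rewrite [a *: _]mulrDr mulrDr; ring.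
have f3 x' y' w : lin1 (fun z' => f x' y' z' w : R^o).
  move=> a x1 x2; rewrite /f curv_op_lin1 curv_op_lin2 curv_op_lin3 !bE' /=.
  by rewrite [a *: _]mulrDr mulrDr; ring.
have l0 : @lin1 R^o (fun=> 0).
  by move=> a u1 u2; rewrite scaler0 addr0.
apply: gform_nondeg => w; rewrite !bE'.
apply: (lin1_ext (f1 y z w) l0) => k.
apply: (lin1_ext (f2 (cvec k) z w) l0) => l.
apply: (lin1_ext (f3 (cvec k) (cvec l) w) l0) => m.
by rewrite /f !curv_op_cvec -!bE' Rc_bianchi !bE'.
Qed.

(** The classical combination of four Bianchi identities, with terms matched by skewness in each
    pair. *)
Lemma curv_op_pair x y z w : b (Rm x y z) w = b (Rm z w x) y.
Proof.
have B t u v s : b (Rm t u v) s + b (Rm u v t) s + b (Rm v t u) s = 0.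
  by rewrite -!bE' curv_op_bianchi !bE'.
have sk t u v s : b (Rm t u v) s = - b (Rm t u s) v.
  by rewrite curv_op_skew gformC.
have an t u v s : b (Rm t u v) s = - b (Rm u t v) s.
  by rewrite curv_op_anti !bE'.
have := B x y z w; have := B y z w x; have := B z w x y; have := B w x y z.
rewrite (an w x y z) (sk x y w z) (an w x z y) (sk x w z y) (sk x z w y).
rewrite (sk y z w x) (sk z w y x) (an w y z x) (sk y w z x) (an z x y w).
lra.
Qed.

End Multilinear.

(** * The pointwise algebra applied to coordinate matrices *)

Section Point.
Context {R : realType} {n : nat}.
Variables (g : 'M[R]_n) (Rc : 'I_n -> 'I_n -> 'M[R]_n).
Hypotheses (g_sym : g^T = g) (g_unit : g \in unitmx).
Hypothesis Rc_anti : forall k l, Rc k l = - Rc l k.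
Hypothesis Rc_skew : forall k l, g *m Rc k l = - ((Rc k l)^T *m g).
Hypothesis Rc_bianchi : forall k l m,
  Rc k l *m cvec m + Rc l m *m cvec k + Rc m k *m cvec l = 0.
Variables (v : 'cV[R]_n) (p : 'I_n -> R).
Hypothesis v0 : v != 0.
Hypothesis Rc_v : forall k l, Rc k l *m v = p l *: cvec k - p k *: cvec l.

Local Notation b := (gform g).
Local Notation Rm := (curv_op Rc).
Let bE' := bE (gformC g_sym) (gformDl g) (gformZl g).
Let binj := @b_inj _ _ b (gformDl g) (gformZl g) (gform_nondeg g_unit).
Let R_skew := curv_op_skew g_sym Rc_skew.
Let R_pair := curv_op_pair g_sym g_unit Rc_anti Rc_skew Rc_bianchi.

Lemma null_curvature : exists K, forall x y, Rm x y v = K *: (b v y *: x - b v x *: y).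
Proof.
pose P (y : 'cV[R]_n) := \sum_k y k 0 * p k.
have PD a y y' : P (a *: y + y') = a * P y + P y'.
  rewrite /P mulr_sumr -big_split; apply: eq_bigr => k _ /=.
  by rewrite !mxE mulrDl mulrA.
have Pc k : P (cvec k) = p k.
  rewrite /P (bigD1 k) //= big1 => [|i ik]; first by rewrite !mxE !eqxx mul1r addr0.
  by rewrite !mxE (negbTE ik) mul0r.
apply: (nullity_curvature (gformC g_sym) (gformDl g) (gformZl g)
  (gform_nondeg g_unit) R_skew v0 (p := P)).
apply: bilinear_ext.
- by move=> y; exact: curv_op_lin1.
- by move=> x; exact: curv_op_lin2.
- by move=> y a x x'; apply: binj => w; rewrite PD !bE'; ring.
- by move=> y a x x'; apply: binj => w; rewrite PD !bE'; ring.
by move=> k l; rewrite curv_op_cvec Rc_v !Pc.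
Qed.

Variable K : R.
Hypothesis R_v : forall x y, Rm x y v = K *: (b v y *: x - b v x *: y).
Local Notation Z := (reduced_curv b Rm K).

Let Z_skew := reduced_skew (gformC g_sym) (gformDl g) (gformZl g) R_skew K.
Let Z_pair := reduced_pair (gformC g_sym) (gformDl g) (gformZl g) R_pair K.
Let Z_v := reduced_v R_v.

Lemma reduced_eq0 lam : (forall x y, Z x y lam = 0) -> forall k l,
  Rc k l *m lam = K *: (b lam (cvec l) *: cvec k - b lam (cvec k) *: cvec l).
Proof.
move=> h k l; have := h (cvec k) (cvec l).
by rewrite /reduced_curv curv_op_cvec => /eqP; rewrite subr_eq0 => /eqP.
Qed.

(** If the component [k0] of [v] is nonzero, then [v] and the coordinate vector of the other index,
    [1 - k0], span the plane. *)
Lemma reduced_curv_dim2 lam : n = 2%N -> forall x y, Z x y lam = 0.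
Proof.
move=> n2 x y.
have [k0 vk0] : exists k, v k 0 != 0.
  apply/existsP; apply: contraNT v0 => /existsPn h.
  by apply/eqP/matrixP => i j; rewrite ord1 [RHS]mxE; apply/eqP/negPn/h.
have lt2 (i : 'I_n) : (i < 2)%N by rewrite -[X in (_ < X)%N]n2.
have [l0 l0k0] : exists l, l != k0.
  have lt : (1 - k0 < n)%N by apply: leq_ltn_trans (leq_subr _ _) _; rewrite n2.
  exists (Ordinal lt); rewrite -val_eqE /=.
  by case: (nat_of_ord k0) (lt2 k0) => [|[|]].
have two i : i != k0 -> i = l0.
  move=> ik; apply/val_inj; move: ik l0k0 (lt2 i) (lt2 k0) (lt2 l0).
  rewrite -!val_eqE /=.
  by case: (nat_of_ord i) (nat_of_ord k0) (nat_of_ord l0) => [|[|?]] [|[|?]] [|[|?]].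
apply: (skew_tensor_dim2 (gformC g_sym) (gformDl g) (gformZl g)
  (gform_nondeg g_unit) Z_skew Z_pair Z_v (w := cvec l0)) => {x y} x.
exists (x k0 0 / v k0 0), (x l0 0 - x k0 0 / v k0 0 * v l0 0).
apply/matrixP => i j; rewrite ord1 !mxE eqxx andbT.
have [->|/two ->] := eqVneq i k0; last by rewrite eqxx mulr1 addrC subrK.
by rewrite eq_sym (negbTE l0k0) mulr0 addr0 divfK.
Qed.

Variables (sig L : 'M[R]_n).
Hypothesis sig_sym : sig^T = sig.
Hypothesis integr : forall k l, Rc k l *m sig + sig *m (Rc k l)^T =
  cvec l *m (L *m cvec k)^T + L *m cvec k *m (cvec l)^T
  - (cvec k *m (L *m cvec l)^T + L *m cvec l *m (cvec k)^T).
Local Notation sg := (sig *m g).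

Lemma col_row_form (x y z : 'cV[R]_n) : x *m y^T *m g *m z = b y z *: x.
Proof. by rewrite -!mulmxA [y^T *m _]mx11_scalar mul_mx_scalar /gform !mulmxA. Qed.

Lemma tr_col_row (x y : 'cV[R]_n) : \tr (g *m (x *m y^T)) = b x y.
Proof.
rewrite mulmxA mxtrace_mulC mulmxA [y^T *m g *m x]mx11_scalar mxtrace_scalar mulr1n.
by rewrite (gformC g_sym).
Qed.

Lemma sg_sym x y : b (sg *m x) y = b x (sg *m y).
Proof. by rewrite gform_mulmx trmx_mul g_sym sig_sym /gform !mulmxA. Qed.

(** Contract [integr] with [g]: the left side has trace zero by skewness of the curvature, and the
    right side gives twice the antisymmetric part of [L]. *)
Lemma L_sym x y : b (L *m x) y = b x (L *m y).
Proof.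
have lb (f : 'cV[R]_n -> 'cV[R]_n) u : lin1 f -> @lin1 R n R^o (fun x => b (f x) u).
  by move=> lf a x1 x2; rewrite lf !bE'.
have lL : lin1 (mulmx L : 'cV[R]_n -> 'cV[R]_n).
  by move=> a x1 x2; rewrite mulmxDr scalemxAr.
rewrite [RHS](gformC g_sym).
apply: (@bilinear_ext _ _ R^o (fun x y => b (L *m x) y) (fun x y => b (L *m y) x)) x y.
- by move=> y; exact: lb.
- by move=> x a y y'; rewrite !bE'.
- by move=> y a x x'; rewrite !bE'.
- by move=> y; exact: lb.
move=> k l.
have := congr1 (fun A => \tr (g *m A)) (integr k l).
have -> : \tr (g *m (Rc k l *m sig + sig *m (Rc k l)^T)) = 0.
  rewrite mulmxDr mxtraceD [X in _ + X](_ : _ = - \tr (g *m (Rc k l *m sig))) ?subrr //.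
  rewrite [g *m (sig *m _)]mulmxA mxtrace_mulC [_^T *m _]mulmxA.
  by rewrite -[_^T *m g]opprK -Rc_skew mulNmx linearN /= mulmxA.
rewrite /= !(mulmxDr, mulmxN) !(mxtraceD, raddfN) /= !(mxtraceD, tr_col_row).
rewrite !(gformC g_sym (cvec _) (L *m _)) => e.
by lra.
Qed.

Lemma integr_op x y z : Rm x y (sg *m z) - sg *m Rm x y z =
    b (L *m x) z *: y + b y z *: (L *m x) - (b (L *m y) z *: x + b x z *: (L *m y)).
Proof.
have lRm (f : 'cV[R]_n -> 'cV[R]_n) : lin1 f -> lin1 (fun u => sg *m f u).
  by move=> lf a u u'; rewrite lf mulmxDr scalemxAr.
apply: (@bilinear_ext _ _ _ (fun x y => Rm x y (sg *m z) - sg *m Rm x y z)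
  (fun x y => b (L *m x) z *: y + b y z *: (L *m x)
    - (b (L *m y) z *: x + b x z *: (L *m y)))) x y.
- move=> y a x x'; rewrite curv_op_lin1 (lRm _ (curv_op_lin1 Rc y z)).
  by apply: binj => w; rewrite !bE'; ring.
- move=> x a y y'; rewrite curv_op_lin2 (lRm _ (curv_op_lin2 Rc x z)).
  by apply: binj => w; rewrite !bE'; ring.
- move=> y a x x'; rewrite !mulmxDr -!scalemxAr.
  by apply: binj => w; rewrite !bE'; ring.
- move=> x a y y'; rewrite !mulmxDr -!scalemxAr.
  by apply: binj => w; rewrite !bE'; ring.
move=> k l; rewrite !curv_op_cvec -!col_row_form.
have := congr1 (fun A => A *m g *m z) (integr k l).
rewrite /= !(mulmxDl, mulNmx) => <-.
rewrite !mulmxA; congr (_ + _).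
by rewrite -[sig *m (Rc k l)^T *m g]mulmxA -[_^T *m g]opprK -Rc_skew !mulmxN !mulNmx !mulmxA.
Qed.

Let Sop : {linear 'cV[R]_n -> 'cV[R]_n} := mulmx sg.
Let Lop : {linear 'cV[R]_n -> 'cV[R]_n} := mulmx L.

Lemma hessian_span : exists tau, L = tau%:M - K *: sg.
Proof.
have [tau h] := @integrability_scalar _ _ _ (gformC g_sym) (gformDl g) (gformZl g)
  (gform_nondeg g_unit) Rm v R_skew R_pair v0 K R_v Sop Lop sg_sym L_sym integr_op.
exists tau; apply/matrixP => i j.
have := congr1 (fun u : 'cV_n => u i 0) (h (cvec j)).
rewrite /= /cvec -!colE !mxE eqxx andbT => ->.
by rewrite mulr_natr.
Qed.

Lemma reduced_commute_sg x y z : Z x y (sg *m z) = sg *m Z x y z.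
Proof.
exact: (@reduced_commute _ _ _ (gformC g_sym) (gformDl g) (gformZl g)
  (gform_nondeg g_unit) Rm v R_skew R_pair v0 K R_v Sop Lop sg_sym L_sym integr_op).
Qed.

Hypothesis n_gt2 : (2 < n)%N.
Let dim_gt2 := gform_dim_gt2 g_sym n_gt2.
Variable lam : 'cV[R]_n.

(* nabla_k sigma as an endomorphism, by the metrisability equation for
   lam = - mu. *)
Definition grad_endo k : 'M[R]_n := (cvec k *m lam^T + lam *m (cvec k)^T) *m g.

Lemma grad_endoE k z : grad_endo k *m z = b lam z *: cvec k + b (cvec k) z *: lam.
Proof. by rewrite /grad_endo !mulmxDl !col_row_form. Qed.

(** The assumed formula is the Ricci identity for [lam] once [nabla lam = tau - K sigma] is
    differentiated. Representing its coefficients by vectors [be] and [et] gives the shape treated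
    by the classification. *)
Lemma annihilated_or_quadratic (a c : 'I_n -> R) :
  (forall k l, Rc k l *m lam =
     a k *: (sg *m cvec l) + c k *: cvec l - (a l *: (sg *m cvec k) + c l *: cvec k)
     - K *: (grad_endo k *m cvec l - grad_endo l *m cvec k)) ->
  (forall x y, Z x y lam = 0) \/
  exists th ka, (sg - th%:M) *m (sg - th%:M) = ka *: (sg - th%:M).
Proof.
move=> h.
have [be beE] := gform_dual g_unit a.
(* One [K] comes from passing from [Rc] to [Z], the other from the [grad_endo] terms. *)
have [et etE] := gform_dual g_unit (fun k => c k + 2 * K * b lam (cvec k)).
have ZE x y : Z x y lam = b be x *: (sg *m y) - b be y *: (sg *m x)
    + (b et x *: y - b et y *: x).
  have lf : lin1 (mulmx sg : 'cV[R]_n -> 'cV[R]_n).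
    by move=> k x1 x2; rewrite mulmxDr scalemxAr.
  apply: (@bilinear_ext _ _ _ (fun x y => Z x y lam) (fun x y =>
    b be x *: (sg *m y) - b be y *: (sg *m x) + (b et x *: y - b et y *: x))) x y.
  - move=> y k x x'; rewrite /reduced_curv curv_op_lin1.
    by apply: binj => w; rewrite !bE'; ring.
  - move=> x k y y'; rewrite /reduced_curv curv_op_lin2.
    by apply: binj => w; rewrite !bE'; ring.
  - move=> y k x x'; rewrite lf.
    by apply: binj => w; rewrite !bE'; ring.
  - move=> x k y y'; rewrite lf.
    by apply: binj => w; rewrite !bE'; ring.
  move=> k l; rewrite /reduced_curv curv_op_cvec h !grad_endoE !beE !etE.
  rewrite (gformC g_sym (cvec l) (cvec k)).
  by apply: binj => w; rewrite !bE'; ring.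
have [|[th [ka hq]]] := @quadratic_or_annihilated _ _ _ (gformC g_sym) (gformDl g)
  (gformZl g) (gform_nondeg g_unit) Z v Sop Z_skew Z_pair v0 Z_v sg_sym dim_gt2
  reduced_commute_sg be et lam ZE; first by left.
right; exists th, ka; apply/matrixP => i j.
have Tx (u : 'cV_n) : sg *m u - th *: u = (sg - th%:M) *m u.
  by rewrite mulmxBl mul_scalar_mx.
have := congr1 (fun u : 'cV_n => u i 0) (hq (cvec j)).
by rewrite /= !Tx mulmxA scalemxAl /cvec -!colE [LHS]mxE [RHS]mxE.
Qed.

(** The last hypothesis is the differentiated relation along coordinate vectors; its linear
    extension is [projector_eq], and [T] is nonzero because [sg] is not scalar. *)
Lemma annihilated_of_quadratic th ka : ~~ is_scalar_mx sg ->
  (sg - th%:M) *m (sg - th%:M) = ka *: (sg - th%:M) ->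
  (forall k, exists p q, grad_endo k *m (sg - th%:M) + (sg - th%:M) *m grad_endo k
     - ka *: grad_endo k = p *: (sg - th%:M) + q%:M) ->
  forall x y, Z x y lam = 0.
Proof.
set T := sg - th%:M => nsc TT h.
have [P hP] := boolp.choice h; have [Q hQ] := boolp.choice hP.
have T_sym x y : b (T *m x) y = b x (T *m y).
  by rewrite !mulmxBl !mul_scalar_mx !bE' sg_sym.
have TTx (x : 'cV_n) : T *m (T *m x) = ka *: (T *m x) by rewrite mulmxA TT -scalemxAl.
have Z_T x y z : Z x y (T *m z) = T *m Z x y z.
  rewrite !mulmxBl !mul_scalar_mx -reduced_commute_sg.
  rewrite (skew_tensorD (gformDl g) (gformZl g) (gform_nondeg g_unit) Z_skew).
  rewrite -scaleNr (skew_tensorZ (gformDl g) (gformZl g) (gform_nondeg g_unit) Z_skew).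
  by rewrite scaleNr.
pose lsum (f : 'I_n -> R) (x : 'cV[R]_n) := \sum_k x k 0 * f k.
have lsumD f a x y : lsum f (a *: x + y) = a * lsum f x + lsum f y.
  rewrite /lsum mulr_sumr -big_split; apply: eq_bigr => k _ /=.
  by rewrite !mxE mulrDl mulrA.
have lsumc f k : lsum f (cvec k) = f k.
  rewrite /lsum (bigD1 k) //= big1 => [|i ik]; first by rewrite !mxE !eqxx mul1r addr0.
  by rewrite !mxE (negbTE ik) mul0r.
apply: (projector_annihilated (gformC g_sym) (gformDl g) (gformZl g)
  (gform_nondeg g_unit) Z_skew dim_gt2 T_sym TTx Z_T (p := lsum P) (t := lsum Q)).
  move=> m z; pose f m := b (T *m lam) z *: m + b m z *: (T *m lam)
    + (b lam z *: (T *m m) + b (T *m m) z *: lam) - ka *: (b lam z *: m + b m z *: lam).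
  apply: (@lin1_ext _ _ _ f (fun m => lsum P m *: (T *m z) + lsum Q m *: z)).
  - move=> a x y; rewrite /f mulmxDr -scalemxAr.
    by apply: binj => w; rewrite !bE'; ring.
  - by move=> a x y; rewrite !lsumD; apply: binj => w; rewrite !bE'; ring.
  move=> k; rewrite !lsumc; have := congr1 (mulmx^~ z) (hQ k).
  rewrite /= [(_ *: T + _) *m z]mulmxDl mul_scalar_mx -(scalemxAl (P k)) => <-.
  rewrite mulmxBl mulmxDl -scalemxAl -(mulmxA (grad_endo k)) -(mulmxA T) !grad_endoE mulmxDr -!scalemxAr.
  rewrite -!T_sym /f.
  by apply: binj => w; rewrite !bE'; ring.
apply: boolp.contrapT => h0; case/negP: nsc; apply/is_scalar_mxP; exists th.
apply/eqP; rewrite -subr_eq0; apply/eqP/matrixP => i j; rewrite -/T.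
have : T *m cvec j = 0.
  by apply/eqP/negPn/negP => Tj; apply: h0; exists (cvec j).
by move/matrixP/(_ i 0); rewrite /cvec -colE !mxE.
Qed.

End Point.

(** * The equation on an open set of coordinates *)

(* [lam] is [- mu] and [om k] is the connection form of the density bundle, whose
   flatness makes the weight invisible in the Ricci identities. *)
Section Local.
Context {R : realType} {n : nat}.
Variables (U : set 'rV[R]_n) (g : 'rV[R]_n -> 'M[R]_n)
  (Gam : 'I_n -> 'rV[R]_n -> 'M[R]_n) (om : 'I_n -> 'rV[R]_n -> R)
  (sig : 'rV[R]_n -> 'M[R]_n) (lam : 'rV[R]_n -> 'cV[R]_n).
Hypothesis U_open : open U.
Hypothesis g_smooth : msmooth U g.
Hypothesis g_sym : forall x, U x -> (g x)^T = g x.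
Hypothesis g_unit : forall x, U x -> g x \in unitmx.
Hypothesis Gam_smooth : forall k, msmooth U (Gam k).
Hypothesis Gam_metric : forall k x, U x ->
  dmx k g x = g x *m Gam k x + (Gam k x)^T *m g x.
Hypothesis Gam_torsion : forall k l x, U x ->
  Gam k x *m cvec l = Gam l x *m cvec k.
Hypothesis om_smooth : forall k, smooth U (om k).
Hypothesis om_flat : forall k l x, U x -> partial k (om l) x = partial l (om k) x.
Hypothesis sig_smooth : msmooth U sig.
Hypothesis sig_sym : forall x, U x -> (sig x)^T = sig x.
Hypothesis lam_smooth : msmooth U lam.
Hypothesis metrisability : forall k x, U x ->
  dmx k sig x = cvec k *m (lam x)^T + lam x *m (cvec k)^T
    - Gam k x *m sig x - sig x *m (Gam k x)^T - om k x *: sig x.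

Definition curv k l x : 'M[R]_n :=
  dmx k (Gam l) x - dmx l (Gam k) x + (Gam k x *m Gam l x - Gam l x *m Gam k x).

Hypothesis nullity : forall x, U x -> exists (v : 'cV[R]_n) (p : 'I_n -> R),
  v != 0 /\ forall k l, curv k l x *m v = p l *: cvec k - p k *: cvec l.

Let dg x : U x -> mdiff g x. Proof. exact: msmooth_mdiff. Qed.
Let dGam k x : U x -> mdiff (Gam k) x. Proof. exact: msmooth_mdiff. Qed.
Let dsig x : U x -> mdiff sig x. Proof. exact: msmooth_mdiff. Qed.
Let dlam x : U x -> mdiff lam x. Proof. exact: msmooth_mdiff. Qed.
Let dom k x : U x -> differentiable (om k) x.
Proof. by move=> Ux; exact: smooth_differentiable (om_smooth k) Ux. Qed.

Lemma curv_anti x k l : curv k l x = - curv l k x.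
Proof. by rewrite /curv opprD !opprB. Qed.

Lemma curv_tr x k l : (curv k l x)^T =
  (dmx k (Gam l) x)^T - (dmx l (Gam k) x)^T
  + ((Gam l x)^T *m (Gam k x)^T - (Gam k x)^T *m (Gam l x)^T).
Proof. by rewrite /curv [(_ + _)^T]linearD /= ![(_ - _)^T]linearB /= !trmx_mul. Qed.

Lemma curv_skew x k l : U x -> g x *m curv k l x = - ((curv k l x)^T *m g x).
Proof.
move=> Ux; rewrite curv_tr.
apply: curvature_skew_identity.
have D i j : dmx i (dmx j g) x =
    (g x *m Gam i x + (Gam i x)^T *m g x) *m Gam j x + g x *m dmx i (Gam j) x
    + ((dmx i (Gam j) x)^T *m g x
       + (Gam j x)^T *m (g x *m Gam i x + (Gam i x)^T *m g x)).
  rewrite (dmx_eq_on U_open i (fun y Uy => Gam_metric j Uy) Ux).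
  have dt := mdiff_tr (dGam j Ux).
  rewrite dmxD; [|exact: mdiffM (dg Ux) (dGam j Ux)|exact: mdiffM dt (dg Ux)].
  by rewrite (dmxM i (dg Ux) (dGam j Ux)) (dmxM i dt (dg Ux)) dmx_tr Gam_metric.
by rewrite -!D (dmxC U_open).
Qed.

(** Torsion-freeness permutes indices in the quadratic terms and, once differentiated, in the
    derivative terms; all then cancel in pairs. *)
Lemma curv_bianchi x k l m : U x ->
  curv k l x *m cvec m + curv l m x *m cvec k + curv m k x *m cvec l = 0.
Proof.
move=> Ux.
have T i j r : dmx i (Gam j) x *m cvec r = dmx i (Gam r) x *m cvec j.
  have e : dmx i (fun y => Gam j y *m cvec r) x = dmx i (fun y => Gam r y *m cvec j) x.
    by apply: (dmx_eq_on U_open) => // y Uy; exact: Gam_torsion.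
  move: e; rewrite !dmxM ?dmx_cst ?mulmx0 ?addr0 //; try exact: mdiff_cst; exact: dGam.
have T2 i j r : Gam i x *m Gam j x *m cvec r = Gam i x *m Gam r x *m cvec j.
  by rewrite -!mulmxA Gam_torsion.
rewrite /curv !mulmxDl !mulNmx.
rewrite (T l m k) (T k m l) (T m l k) (T2 l m k) (T2 k m l) (T2 m l k).
move: (dmx k _ x *m _) (dmx l _ x *m _) (dmx m _ x *m _) => a1 a2 a3.
move: (Gam k x *m _ *m _) (Gam l x *m _ *m _) (Gam m x *m _ *m _) => b1 b2 b3.
by apply/matrixP => i j; rewrite !mxE; ring.
Qed.

(** By skewness the curvature is conjugate under [g] to minus its transpose. This will make the
    density connection flat. *)
Lemma curv_trace0 x k l : U x -> \tr (curv k l x) = 0.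
Proof.
move=> Ux; suff : \tr (curv k l x) = - \tr (curv k l x) by lra.
have {1}-> : curv k l x = - (invmx (g x) *m (curv k l x)^T *m g x).
  by rewrite -mulmxA -mulNmx -[LHS](mulKmx (g_unit Ux)) curv_skew // mulmxN mulNmx.
by rewrite linearN /= mxtrace_mulC mulmxA mulmxV ?g_unit // mul1mx mxtrace_tr.
Qed.

(* The column [k] of [hess x] is nabla_k lam. *)
Definition hess x : 'M[R]_n :=
  \matrix_(i, k) (dmx k lam x + Gam k x *m lam x + om k x *: lam x) i 0.

Lemma hess_cvec x k :
  hess x *m cvec k = dmx k lam x + Gam k x *m lam x + om k x *: lam x.
Proof. by apply/matrixP => i j; rewrite ord1 /cvec -colE !mxE. Qed.

Lemma hess_smooth : msmooth U hess.
Proof.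
move=> i k; under eq_fun do rewrite mxE.
have : msmooth U (fun x => dmx k lam x + Gam k x *m lam x + om k x *: lam x).
  apply: (msmoothD U_open); first apply: (msmoothD U_open).
  - exact: msmooth_dmx.
  - exact: (msmoothM U_open).
  - exact: (msmoothZ U_open).
by apply.
Qed.

Let dhess x : U x -> mdiff hess x. Proof. exact: msmooth_mdiff hess_smooth. Qed.

Lemma ricci_sigma x k l : U x ->
  curv k l x *m sig x + sig x *m (curv k l x)^T =
  cvec l *m (hess x *m cvec k)^T + hess x *m cvec k *m (cvec l)^T
  - (cvec k *m (hess x *m cvec l)^T + hess x *m cvec l *m (cvec k)^T).
Proof.
move=> Ux.
have hessT i : (hess x *m cvec i)^T =
    (dmx i lam x)^T + (lam x)^T *m (Gam i x)^T + om i x *: (lam x)^T.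
  by rewrite hess_cvec linearD /= linearZ /= [(_ + _)^T]linearD /= trmx_mul.
rewrite !hessT !hess_cvec curv_tr.
apply: (ricci_sym2_identity (c := partial l (om k) x) (metrisability k Ux) (metrisability l Ux)).
- exact: Gam_torsion.
- by rewrite -!trmx_mul Gam_torsion.
have D i j : dmx i (dmx j sig) x =
   cvec j *m (dmx i lam x)^T + dmx i lam x *m (cvec j)^T
   - (dmx i (Gam j) x *m sig x + Gam j x *m dmx i sig x)
   - (dmx i sig x *m (Gam j x)^T + sig x *m (dmx i (Gam j) x)^T)
   - (partial i (om j) x *: sig x + om j x *: dmx i sig x).
  rewrite (dmx_eq_on U_open i (fun y Uy => metrisability j Uy) Ux).
  have dc (A : 'cV[R]_n) := mdiff_cst A x.
  have dct (A : 'rV[R]_n) := mdiff_cst A x.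
  have dlt := mdiff_tr (dlam Ux).
  have dGt := mdiff_tr (dGam j Ux).
  have d1 := mdiffM (dc (cvec j)) dlt.
  have d2 := mdiffM (dlam Ux) (dct (cvec j)^T).
  have d3 := mdiffM (dGam j Ux) (dsig Ux).
  have d4 := mdiffM (dsig Ux) dGt.
  have d5 := mdiffZ (dom j Ux) (dsig Ux).
  have d12 := mdiffD d1 d2.
  have d123 := mdiffD d12 (mdiffN d3).
  have d1234 := mdiffD d123 (mdiffN d4).
  rewrite (dmxD i d1234 (mdiffN d5)) (dmxD i d123 (mdiffN d4)) (dmxD i d12 (mdiffN d3)).
  rewrite (dmxD i d1 d2) (dmxN i d3) (dmxN i d4) (dmxN i d5).
  rewrite (dmxM i (dc _) dlt) (dmxM i (dlam Ux) (dct _)) (dmxM i (dGam j Ux) (dsig Ux)).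
  rewrite (dmxM i (dsig Ux) dGt) (dmxZ i (dom j Ux) (dsig Ux)) !dmx_cst !dmx_tr.
  by rewrite mul0mx mulmx0 add0r addr0.
by rewrite -D {1}(om_flat l k Ux) -D (dmxC U_open _ _ sig_smooth Ux).
Qed.

Definition sigma_endo x : 'M[R]_n := sig x *m g x.

Let dsg x : U x -> mdiff sigma_endo x.
Proof. by move=> Ux; exact: mdiffM (dsig Ux) (dg Ux). Qed.

Lemma dmx_sigma_endo x k : U x -> dmx k sigma_endo x =
  grad_endo (g x) (lam x) k - Gam k x *m sigma_endo x + sigma_endo x *m Gam k x
  - om k x *: sigma_endo x.
Proof.
move=> Ux; rewrite /sigma_endo (dmxM k (dsig Ux) (dg Ux)) Gam_metric // metrisability //.
exact: sym2_endo_derivative.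
Qed.

(** The Christoffel terms for the lower index of [hess] are left out: they are symmetric in [k] and
    [l]. *)
Lemma ricci_lam x k l : U x -> curv k l x *m lam x =
  dmx k hess x *m cvec l + Gam k x *m (hess x *m cvec l) + om k x *: (hess x *m cvec l)
  - (dmx l hess x *m cvec k + Gam l x *m (hess x *m cvec k)
     + om l x *: (hess x *m cvec k)).
Proof.
move=> Ux; rewrite !hess_cvec.
have D i j : dmx i hess x *m cvec j = dmx i (dmx j lam) x
    + (dmx i (Gam j) x *m lam x + Gam j x *m dmx i lam x)
    + (partial i (om j) x *: lam x + om j x *: dmx i lam x).
  have dc := mdiff_cst (cvec j) x.
  have -> : dmx i hess x *m cvec j = dmx i (fun y => hess y *m cvec j) x.
    by rewrite (dmxM i (dhess Ux) dc) dmx_cst mulmx0 addr0.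
  rewrite (dmx_eq_on U_open i (fun y (_ : U y) => hess_cvec y j) Ux).
  have d1 : mdiff (dmx j lam) x by exact: msmooth_mdiff (msmooth_dmx j lam_smooth) Ux.
  have d2 := mdiffM (dGam j Ux) (dlam Ux).
  have d3 := mdiffZ (dom j Ux) (dlam Ux).
  rewrite (dmxD i (mdiffD d1 d2) d3) (dmxD i d1 d2).
  by rewrite (dmxM i (dGam j Ux) (dlam Ux)) (dmxZ i (dom j Ux) (dlam Ux)).
apply: (ricci_vector_identity (D l k)).
by rewrite (dmxC U_open l k lam_smooth Ux) -(om_flat k l Ux).
Qed.

(** The coefficients are found point by point, with no regularity in [x]; [dmx_span] is what allows
    differentiating this relation. *)
Lemma hess_span x : U x -> exists a c, hess x = a *: sigma_endo x + c%:M.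
Proof.
move=> Ux; have [v [p [v0 Rv]]] := nullity Ux.
have [K RK] := null_curvature (g_sym Ux) (g_unit Ux) (fun k l => curv_skew k l Ux) v0 Rv.
have [tau ->] := hessian_span (g_sym Ux) (g_unit Ux) (curv_anti x)
  (fun k l => curv_skew k l Ux) (fun k l m => curv_bianchi k l m Ux) v0 RK (sig_sym Ux)
  (fun k l => ricci_sigma k l Ux).
by exists (- K), tau; rewrite addrC scaleNr.
Qed.

(* That is, Z lam = 0. *)
Definition lam_constant x := exists K, forall k l, curv k l x *m lam x =
  K *: (gform (g x) (lam x) (cvec l) *: cvec k - gform (g x) (lam x) (cvec k) *: cvec l).

Lemma lam_constant_dim2 x : n = 2%N -> U x -> lam_constant x.
Proof.
move=> n2 Ux; have [v [p [v0 Rv]]] := nullity Ux.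
have [K RK] := null_curvature (g_sym Ux) (g_unit Ux) (fun k l => curv_skew k l Ux) v0 Rv.
exists K; apply: reduced_eq0.
exact: (reduced_curv_dim2 (g_sym Ux) (g_unit Ux) (curv_anti x)
  (fun k l => curv_skew k l Ux) (fun k l m => curv_bianchi k l m Ux) v0 RK (lam x) n2).
Qed.

Hypothesis n_gt1 : (1 < n)%N.

Definition ricci_lam_comp k x : R :=
  (\sum_a (curv a k x *m lam x) a 0) / n.-1%:R.

(* The vector of components [W^i_{jkl} lam^j]. *)
Definition weyl_lam k l x : 'cV[R]_n :=
  curv k l x *m lam x + (ricci_lam_comp k x *: cvec l - ricci_lam_comp l x *: cvec k).

(** Tracing the constant curvature formula yields the factor [n - 1], which the division in
    [ricci_lam_comp] removes; the correction then cancels the curvature term. *)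
Lemma weyl_lam_eq0 k l x : lam_constant x -> weyl_lam k l x = 0.
Proof.
move=> [K RK]; have ric m : ricci_lam_comp m x = K * gform (g x) (lam x) (cvec m).
  rewrite /ricci_lam_comp; under eq_bigr do rewrite RK !mxE !eqxx /= mulr1 andbT.
  rewrite -mulr_sumr sumrB sumr_const card_ord (bigD1 m) //= eqxx mulr1.
  rewrite big1 => [|i im]; last by rewrite (negbTE im) mulr0.
  have n1 : n.-1%:R != 0 :> R by rewrite pnatr_eq0 -lt0n -subn1 subn_gt0.
  rewrite addr0 -[X in _ *+ X](ltn_predK n_gt1) mulrSr addrK.
  by rewrite -[X in K * X]mulr_natr mulrA mulfK.
rewrite /weyl_lam RK !ric; apply/matrixP => i j; rewrite !mxE; ring.
Qed.

Lemma curv_lam_smooth k l : msmooth U (fun x => curv k l x *m lam x).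
Proof.
apply: (msmoothM U_open) => //; apply: (msmoothD U_open).
  apply: (msmoothD U_open); first exact: msmooth_dmx.
  by apply: (msmoothN U_open); exact: msmooth_dmx.
by apply: (msmoothD U_open); [|apply: (msmoothN U_open)]; exact: (msmoothM U_open).
Qed.

Lemma weyl_lam_smooth k l : msmooth U (weyl_lam k l).
Proof.
have ric m : smooth U (ricci_lam_comp m).
  apply: (smoothM U_open); last exact: smooth_cst.
  by apply: (smooth_sum U_open) => a; exact: curv_lam_smooth.
apply: (msmoothD U_open); first exact: curv_lam_smooth.
apply: (msmoothD U_open); last apply: (msmoothN U_open).
  by apply: (msmoothZ U_open) => //; exact: msmooth_cst.
by apply: (msmoothZ U_open) => //; exact: msmooth_cst.
Qed.

(** * Dimension at least 3 *)

Section Dimension3.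
Hypothesis n_gt2 : (2 < n)%N.

Lemma lam_constant_or_quadratic x : U x -> ~~ is_scalar_mx (sigma_endo x) ->
  lam_constant x \/ exists th ka, (sigma_endo x - th%:M) *m (sigma_endo x - th%:M)
    = ka *: (sigma_endo x - th%:M).
Proof.
move=> Ux nsc; have [v [p [v0 Rv]]] := nullity Ux.
have [K RK] := null_curvature (g_sym Ux) (g_unit Ux) (fun k l => curv_skew k l Ux) v0 Rv.
have [tau hE] := hessian_span (g_sym Ux) (g_unit Ux) (curv_anti x)
  (fun k l => curv_skew k l Ux) (fun k l m => curv_bianchi k l m Ux) v0 RK (sig_sym Ux)
  (fun k l => ricci_sigma k l Ux).
have hE' : hess x = - K *: sigma_endo x + tau%:M by rewrite hE addrC scaleNr.
have spn : \forall y \near x, exists a c, hess y = a *: sigma_endo y + c%:M.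
  by apply: (filterS _ (near_open U_open Ux)) => y /hess_span.
have dh k := dmx_span k (dhess Ux) (dsg Ux) spn nsc hE'.
have [a hA] := boolp.choice dh; have [c hC] := boolp.choice hA.
have [||] := annihilated_or_quadratic (g_sym Ux) (g_unit Ux) (curv_anti x)
  (fun k l => curv_skew k l Ux) (fun k l m => curv_bianchi k l m Ux) v0 RK (sig_sym Ux)
  (fun k l => ricci_sigma k l Ux) n_gt2 (lam := lam x) (a := a)
  (c := fun k => c k + om k x * tau).
- move=> k l; rewrite ricci_lam //.
  have hk m := hC m; rewrite -scaleNr.
  apply: (ricci_span_identity hE' (Gam_torsion k l Ux)).
    by rewrite hC dmx_sigma_endo.
  by rewrite hC dmx_sigma_endo.
- by move=> Z0; left; exists K; exact: reduced_eq0.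
- by right.
Qed.

(** Near [x] the square of [sigma_endo] lies in the span of [sigma_endo] and the identity, so
    [dmx_span] differentiates the relation. *)
Lemma lam_constant_of_quadratic x : U x -> ~~ is_scalar_mx (sigma_endo x) ->
  (\forall y \near x, exists th ka, (sigma_endo y - th%:M) *m (sigma_endo y - th%:M)
    = ka *: (sigma_endo y - th%:M)) ->
  lam_constant x.
Proof.
move=> Ux nsc quad; have [v [p [v0 Rv]]] := nullity Ux.
have [K RK] := null_curvature (g_sym Ux) (g_unit Ux) (fun k l => curv_skew k l Ux) v0 Rv.
have sq (S : 'M[R]_n) th ka : (S - th%:M) *m (S - th%:M) = ka *: (S - th%:M) ->
    S *m S = (ka + 2 * th) *: S + (- (th * (th + ka)))%:M.
  rewrite !(mulmxBl, mulmxBr) !mul_scalar_mx !mul_mx_scalar => E.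
  apply/matrixP => i j; have := congr1 (fun A : 'M[R]_n => A i j) E.
  rewrite !mxE -!(mulr_natr th) -!(mulr_natr (- _)) => e; lra.
have [th [ka hq]] := nbhs_singleton quad.
have spn : \forall y \near x, exists a c,
    sigma_endo y *m sigma_endo y = a *: sigma_endo y + c%:M.
  apply: filterS quad => y [t [k hy]].
  by exists (k + 2 * t), (- (t * (t + k))); exact: sq.
have dsq := mdiffM (dsg Ux) (dsg Ux).
exists K; apply: reduced_eq0.
apply: (annihilated_of_quadratic (g_sym Ux) (g_unit Ux) (curv_anti x)
  (fun k l => curv_skew k l Ux) (fun k l m => curv_bianchi k l m Ux) v0 RK (sig_sym Ux)
  (fun k l => ricci_sigma k l Ux) n_gt2 nsc hq).
move=> k; have [a' [c' e]] := dmx_span k dsq (dsg Ux) spn nsc (sq _ _ _ hq).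
rewrite (dmxM k (dsg Ux) (dsg Ux)) in e.
have := quadratic_derivative_identity (dmx_sigma_endo k Ux) (sq _ _ _ hq) e.
rewrite -/(sigma_endo x); move: (grad_endo _ _ k) (sigma_endo x) (a' + _) (c' + _).
(* [P * th] compensates for replacing [S] by [S - th]. *)
move=> H S P Q E; exists P, (Q + P * th); apply/matrixP => i j.
have := congr1 (fun A : 'M[R]_n => A i j) E.
rewrite !(mulmxBl, mulmxBr) !mul_scalar_mx !mul_mx_scalar.
by rewrite !mxE -(mulr_natr Q) -(mulr_natr (Q + _)) -(mulr_natr th) => e'; lra.
Qed.

(** Commutators with a scalar vanish, so [cvec m0 o lam] is scalar; having rank at most 2 it is
    zero. *)
Lemma lam_eq0_of_scalar x : U x ->
  (\forall y \near x, is_scalar_mx (sigma_endo y)) -> lam x = 0.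
Proof.
move=> Ux sc; have /is_scalar_mxP[s sE] := nbhs_singleton sc.
have [m0 _] : exists m : 'I_n, True by exists (Ordinal (ltnW (ltnW n_gt2))).
have [c cE] := dmx_scalar m0 sc.
have bE' := bE (gformC (g_sym Ux)) (gformDl (g x)) (gformZl (g x)).
have H z : gform (g x) (lam x) z *: cvec m0 + gform (g x) (cvec m0) z *: lam x
    = (c + om m0 x * s) *: z.
  rewrite -grad_endoE -mul_scalar_mx; congr (_ *m _).
  have := dmx_sigma_endo m0 Ux; rewrite cE sE mul_mx_scalar mul_scalar_mx => E.
  apply/matrixP => i j; have := congr1 (fun A : 'M[R]_n => A i j) E.
  by rewrite !mxE -(mulr_natr c) -(mulr_natr s) -(mulr_natr (c + _)) => e; lra.
have [z [z0 lz mz]] := gform_dim_gt2 (g_sym Ux) n_gt2 (lam x) (cvec m0).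
have c0 : c + om m0 x * s = 0.
  have /esym/eqP := H z; rewrite lz mz !scale0r addr0 scaler_eq0 (negbTE z0) orbF.
  by move/eqP.
apply: (@sym_mul_eq0 _ _ (gform (g x)) (gformC (g_sym Ux)) (gformDl (g x)) (gformZl (g x))
  (gform_nondeg (g_unit Ux)) (cvec m0)).
  by move=> y; rewrite H c0 scale0r.
apply/eqP => /matrixP/(_ m0 0); rewrite !mxE !eqxx => /eqP.
by rewrite oner_eq0.
Qed.

Lemma nonscalar_near x : U x -> ~~ is_scalar_mx (sigma_endo x) ->
  \forall y \near x, ~~ is_scalar_mx (sigma_endo y).
Proof.
move=> Ux /nonscalar_entry[i [j [k [l [c [e ne]]]]]].
have sm : smooth U (fun y => sigma_endo y i j + (- c) * sigma_endo y k l).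
  have S : msmooth U sigma_endo by exact: (msmoothM U_open).
  by apply: (smoothD U_open) => //; apply: (smoothM U_open) => //; exact: smooth_cst.
have ne' : sigma_endo x i j + (- c) * sigma_endo x k l != 0 by rewrite mulNr.
have nz : \forall y \near x, sigma_endo y i j + (- c) * sigma_endo y k l != 0.
  exact: cvgr_neq0 _ (smooth_continuous sm Ux) ne'.
apply: filterS nz => y; apply: contraNN => /is_scalar_mxP[s ->].
by rewrite !mxE -(mulr_natr s) -(mulr_natr s (k == l)) mulNr mulrCA -mulrBr e mulr0.
Qed.

Lemma weyl_lam_vanishes_dim3 k l x : U x -> weyl_lam k l x = 0.
Proof.
move=> Ux; apply/matrixP => i j; rewrite [RHS]mxE ord1 {j}; apply/eqP/negPn/negP => W0.
(* An open set on which [lam_constant] fails everywhere. *)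
pose V y := U y /\ weyl_lam k l y i 0 != 0.
have nearV y : V y -> \forall z \near y, V z.
  move=> [Uy Wy]; have cW := smooth_continuous (weyl_lam_smooth k l i 0) Uy.
  exact: (filterI (near_open U_open Uy) (cvgr_neq0 _ cW Wy)).
have V_nonconst y : V y -> ~ lam_constant y.
  by move=> [_ Wy] /(weyl_lam_eq0 k l) W; move: Wy; rewrite W mxE eqxx.
have Vx : V x by [].
(* Were sigma scalar on all of [V], [lam] would vanish at [x] and [lam_constant x] would hold
   trivially. *)
have [q [Vq nsc]] : exists q, V q /\ ~~ is_scalar_mx (sigma_endo q).
  apply: contrapT => /forallNP h; apply: (V_nonconst x Vx).
  have lam0 : lam x = 0.
    apply: lam_eq0_of_scalar => //; apply: (filterS _ (nearV x Vx)) => y Vy.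
    by apply/negPn/negP => nsc; apply: (h y).
  by exists 0 => r s; rewrite lam0 mulmx0 scale0r.
apply: (V_nonconst q Vq); apply: lam_constant_of_quadratic => //; first exact: Vq.1.
(* Near [q] only the quadratic alternative remains, so the relation holds on a neighbourhood and can
   be differentiated. *)
apply: (filterS _ (filterI (nearV q Vq) (nonscalar_near Vq.1 nsc))) => y [Vy nscy].
by have [/(V_nonconst y Vy)//|] := lam_constant_or_quadratic Vy.1 nscy.
Qed.

End Dimension3.

Theorem weyl_lam_vanishes k l x : U x -> weyl_lam k l x = 0.
Proof.
move=> Ux; move: n_gt1; rewrite leq_eqVlt => /orP[/eqP n2|n2].
  by apply: weyl_lam_eq0; exact: lam_constant_dim2.
exact: weyl_lam_vanishes_dim3.
Qed.

End Local.

(** * Charts *)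

Section Chart.
Context {R : realType} {n : nat} {M : manifold R n}.
Variables (g : metric M) (ch : chart M).
Local Notation U := (chart_image ch).
Let U_open : open U. Proof. exact: image_open. Qed.

Definition christoffel_mx k x : 'M[R]_n := \matrix_(i, j) christoffel g ch i k j x.

Definition christoffel_lower k x : 'M[R]_n := \matrix_(e, j)
  (partial k (fun y => g ch y e j) x + partial j (fun y => g ch y e k) x
   - partial e (fun y => g ch y k j) x).

Lemma partial_metric_sym x k i j : U x ->
  partial k (fun y => g ch y i j) x = partial k (fun y => g ch y j i) x.
Proof.
move=> Ux; apply: (partial_eq_on U_open) => // y Uy.
by rewrite -[in LHS](Defs.metric_sym g Uy) mxE.
Qed.

Lemma christoffel_mxE k x :
  christoffel_mx k x = 2^-1 *: (invmx (g ch x) *m christoffel_lower k x).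
Proof.
by apply/matrixP => i j; rewrite !mxE; congr (_ * _); apply: eq_bigr => e _; rewrite mxE.
Qed.

Lemma metric_msmooth : msmooth U (g ch).
Proof. by move=> i j; exact: metric_smooth. Qed.

Lemma christoffel_mx_smooth k : msmooth U (christoffel_mx k).
Proof.
apply: (@msmooth_ext _ _ _ U_open _ _ (fun x => 2^-1 *: (invmx (g ch x) *m christoffel_lower k x))).
  by move=> x _; rewrite christoffel_mxE.
apply: (msmoothZ U_open); first exact: smooth_cst.
apply: (msmoothM U_open).
  by apply: (msmooth_inv U_open); [exact: metric_nondeg|exact: metric_msmooth].
have sp a b c : smooth U (partial a (fun y => g ch y b c)).
  exact/smooth_partial/metric_msmooth.
move=> e j; under eq_fun do rewrite mxE.
by apply: (smoothD U_open); [exact: (smoothD U_open)|exact: (smoothN U_open)].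
Qed.

Lemma christoffel_sym x i j k : U x ->
  christoffel g ch i j k x = christoffel g ch i k j x.
Proof.
move=> Ux; congr (_ * _); apply: eq_bigr => e _; congr (_ * _).
by rewrite (partial_metric_sym e j k Ux) [X in X - _]addrC.
Qed.

(** In the lowered Christoffel symbols plus their transpose only d_k g survives. *)
Lemma christoffel_mx_metric k x : U x ->
  dmx k (g ch) x = g ch x *m christoffel_mx k x + (christoffel_mx k x)^T *m g ch x.
Proof.
move=> Ux; have ug := metric_nondeg g Ux.
have E : g ch x *m christoffel_mx k x = 2^-1 *: christoffel_lower k x.
  by rewrite christoffel_mxE -scalemxAr mulKVmx.
have -> : (christoffel_mx k x)^T *m g ch x = (g ch x *m christoffel_mx k x)^T.
  by rewrite trmx_mul (Defs.metric_sym g Ux).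
rewrite E; apply/matrixP => i j; rewrite !mxE.
rewrite (partial_metric_sym k j i Ux) (partial_metric_sym i j k Ux).
by rewrite (partial_metric_sym j i k Ux); lra.
Qed.

Lemma christoffel_mx_torsion k l x : U x ->
  christoffel_mx k x *m cvec l = christoffel_mx l x *m cvec k.
Proof.
move=> Ux; apply/matrixP => i j; rewrite /cvec -!colE !mxE.
exact: christoffel_sym.
Qed.

Lemma curv_riemann x i j k l : curv christoffel_mx k l x i j = riemann g ch x i j k l.
Proof.
rewrite /curv /riemann !mxE sumrB; congr (_ - _ + (_ - _)).
- by congr partial; apply/funext => y; rewrite mxE.
- by congr partial; apply/funext => y; rewrite mxE.
- by apply: eq_bigr => e _; rewrite !mxE.
- by apply: eq_bigr => e _; rewrite !mxE.
Qed.

(** The trace is the connection form of the top exterior power of TM, and [E(w)] is its power of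
    exponent [w / (n + 1)]. *)
Definition density_form (w : R) k x : R := w / n.+1%:R * \tr (christoffel_mx k x).

Lemma density_form_smooth w k : smooth U (density_form w k).
Proof.
apply: (smoothM U_open); first exact: smooth_cst.
by apply: (smooth_sum U_open) => i; exact: christoffel_mx_smooth.
Qed.

(** The curvature has trace zero and so does the commutator in it, which leaves the two derivative
    terms equal. *)
Lemma density_form_flat w k l x : U x ->
  partial k (density_form w l) x = partial l (density_form w k) x.
Proof.
move=> Ux.
have dC a i j : differentiable (fun y => christoffel_mx a y i j) x.
  exact: smooth_differentiable (christoffel_mx_smooth a i j) Ux.
have P a c : partial a (density_form w c) x = w / n.+1%:R * \tr (dmx a (christoffel_mx c) x).
  rewrite partialM; [|exact: differentiable_cst|exact: differentiable_bigsum].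
  rewrite partial_cst mul0r add0r; congr (_ * _).
  rewrite /mxtrace partial_bigsum => [|i]; last exact: dC.
  by apply: eq_bigr => i _; rewrite [RHS]dmxE.
transitivity (w / n.+1%:R * \tr (dmx k (christoffel_mx l) x)); first exact: P.
transitivity (w / n.+1%:R * \tr (dmx l (christoffel_mx k) x)); last exact: esym (P l k).
have tr_eq (c : R) (A B C D : 'M[R]_n) :
    \tr (A - B + (C *m D - D *m C)) = 0 -> c * \tr A = c * \tr B.
  rewrite mxtraceD !raddfB /= (mxtrace_mulC D) subrr addr0 => /eqP.
  by rewrite subr_eq0 => /eqP ->.
apply: (tr_eq _ _ _ (christoffel_mx k x) (christoffel_mx l x)).
exact: (curv_trace0 U_open metric_msmooth (fun x => @metric_nondeg _ _ _ g ch x)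
  christoffel_mx_smooth christoffel_mx_metric
  k l Ux).
Qed.

Lemma weyl_contract (lam : 'rV[R]_n -> 'cV[R]_n) x a k l : (1 < n)%N ->
  \sum_b lam x b 0 * weyl g ch x a b k l = weyl_lam christoffel_mx lam k l x a 0.
Proof.
move=> n1; rewrite /weyl_lam /weyl !mxE !eqxx !andbT.
have S c : \sum_b lam x b 0 * schouten g ch x b c = ricci_lam_comp christoffel_mx lam c x.
  rewrite /schouten /ricci_lam_comp.
  under eq_bigr do rewrite mulrA.
  rewrite -mulr_suml; congr (_ / _).
  under eq_bigr do rewrite /ricci mulr_sumr.
  rewrite exchange_big; apply: eq_bigr => e _; rewrite mxE.
  by apply: eq_bigr => b _; rewrite curv_riemann mulrC.
rewrite -!S !mulr_suml -sumrB -big_split; apply: eq_bigr => b _ /=.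
by rewrite curv_riemann; ring.
Qed.

End Chart.

(** * From one chart back to the manifold *)

Theorem theorem4p19 (R : realType) (n : nat) (hn : (2 <= n)%N)
    (M : manifold R n)
    (m : set (metric M)) (hm : metric_projective_structure m)
    (g : metric M) (hg : m g)
    (hW : forall p : M, weyl_nullity g p)
    (sigma : wsym2 M (-2)) (mu : wvector M (-2))
    (hmu : metrisability_eq g sigma mu) :
  forall (ch : chart M) (p : M), dom ch p -> forall a c d : 'I_n,
    \sum_(b < n) mu ch (chart_map ch p) 0 b * weyl g ch (chart_map ch p) a b c d = 0.
Proof.
move=> ch p pch a k l.
have Ux : chart_image ch (chart_map ch p) by exists p.
have U_open : open (chart_image ch) by exact: image_open.
pose lam x := - (mu ch x)^T.
have lam_smooth : msmooth (chart_image ch) lam.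
  apply: (msmoothN U_open); apply: msmooth_tr => i j.
  by rewrite ord1; exact: wvector_smooth.
have null x : chart_image ch x -> exists (v : 'cV[R]_n) (q : 'I_n -> R), v != 0 /\
    forall k l, curv (christoffel_mx g ch) k l x *m v = q l *: cvec k - q k *: cvec l.
  move=> [r rch <-]; have [v [tv [c rc vc0] Wv]] := hW r.
  (* The vector is nonzero in some chart [c]; the transition rule carries this over to [ch]. *)
  have v0 : v ch != 0.
    by apply: contraNneq vc0 => v0; rewrite (tv ch c) // v0 mul0mx.
  (* The form is the contraction of the Schouten tensor with [v]: by definition of [weyl], nullity
     expresses the curvature applied to [v] through it. *)
  exists (v ch)^T, (fun j => \sum_b (v ch)^T b 0 * schouten g ch (chart_map ch r) b j).
  split; first by rewrite -(inj_eq (@trmx_inj _ _ _)) trmxK trmx0.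
  move=> i j; apply/matrixP => s t; rewrite ord1 !mxE !eqxx !andbT.
  rewrite !mulr_suml -sumrB; apply/eqP; rewrite -subr_eq0 -sumrB.
  rewrite -[X in _ == X](Wv ch rch s i j); apply/eqP/eq_bigr => b _.
  by rewrite curv_riemann /weyl !mxE; ring.
have metr b x : chart_image ch x -> dmx b (sigma ch) x =
    cvec b *m (lam x)^T + lam x *m (cvec b)^T - christoffel_mx g ch b x *m sigma ch x
    - sigma ch x *m (christoffel_mx g ch b x)^T - density_form g ch (-2) b x *: sigma ch x.
  move=> xU; apply/matrixP => i j; have := hmu ch x xU b i j.
  rewrite /cov_sym2 !mxE !big_ord1 !mxE !eqxx !andbT.
  have -> : \sum_e christoffel g ch i b e x * sigma ch x e j
      = \sum_e christoffel_mx g ch b x i e * sigma ch x e j.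
    by apply: eq_bigr => e _; rewrite mxE.
  have -> : \sum_e christoffel g ch j b e x * sigma ch x i e
      = \sum_e sigma ch x i e * (christoffel_mx g ch b x)^T e j.
    by apply: eq_bigr => e _; rewrite !mxE mulrC.
  (* The two traces contract different lower indices and agree by symmetry of the Christoffel
     symbols. *)
  have -> : \sum_e christoffel g ch e e b x = \tr (christoffel_mx g ch b x).
    by apply: eq_bigr => e _; rewrite mxE christoffel_sym.
  have solve (P A B T d1 m1 d2 m2 : R) : P + A + B + T + d1 * m1 + d2 * m2 = 0 ->
    P = d1 * - m1 + - m2 * d2 - A - B - T by move=> e; lra.
  exact: solve.
have := weyl_lam_vanishes U_open (metric_msmooth g ch) (fun x => @Defs.metric_sym _ _ _ g ch x)
  (fun x => @metric_nondeg _ _ _ g ch x) (christoffel_mx_smooth g ch)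
  (@christoffel_mx_metric _ _ _ g ch) (@christoffel_mx_torsion _ _ _ g ch)
  (density_form_smooth g ch (-2)) (@density_form_flat _ _ _ g ch (-2))
  (fun i j => wsym2_smooth sigma ch i j) (fun x => @wsym2_sym _ _ _ _ sigma ch x)
  lam_smooth metr null hn k l Ux.
move/matrixP/(_ a 0); rewrite -weyl_contract // mxE => e.
apply: oppr_inj; rewrite oppr0 -[RHS]e -sumrN; apply: eq_bigr => b _.
by rewrite !mxE; ring.
Qed.
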